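(* Let $n\ge1$ and $e\ge2$ be integers, $l=2$, and let $\mathbf{s}=(s_1,s_2)\in\mathbb{Z}^2$ with $s_1=s_2$. Then $$((n),\emptyset)_{\theta_{\mathbf{s}}}=(\emptyset,(n))_{\theta_{\mathbf{s}}}=((n),\emptyset),$$ $$((1^n),\emptyset)_{\theta_{\mathbf{s}}}=(\emptyset,(1^n))_{\theta_{\mathbf{s}}}=\big(\mathsf{m}_e(n),\emptyset\big),$$ where $\mathsf{m}_e(n):=((q+1)^r,q^{e-1-r})$ with $n=q(e-1)+r$, $q\ge0$, $0\le r\le e-2$ (the image of the partition $(n)$ under the Mullineux involution in type $A$).
   Context: **Hecke algebra of type $B_n$.** Let $A=\mathbb{C}[q^{\pm1},Q_1,Q_2]$ with $q,Q_1,Q_2$ indeterminates (this $q$ is unrelated to the quotient $q$ of the claim), and $K=\mathrm{Frac}(A)$. $\mathcal{H}$ is the associative $A$-algebra generated by $T_0,\dots,T_{n-1}$ with relations $(T_0-Q_1)(T_0-Q_2)=0$, $(T_i-q)(T_i+1)=0$ ($1\le i\le n-1$), $(T_0T_1)^2=(T_1T_0)^2$, $T_iT_{i+1}T_i=T_{i+1}T_iT_{i+1}$ ($1\le i\le n-2$), $T_iT_j=T_jT_i$ ($j\ge i+2$). A $2$-partition $\boldsymbol{\lambda}=(\lambda^1,\lambda^2)\vdash_2 n$ is a pair of partitions of total size $n$ (partitions are extended by infinitely many zero parts; exponents denote repeated parts). The algebra $K\mathcal{H}$ is split semisimple with simple modules $KV^{\boldsymbol{\lambda}}$, $\boldsymbol{\lambda}\vdash_2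 n$; $KV^{\boldsymbol{\lambda}}$ is characterized by having a basis indexed by standard $\boldsymbol{\lambda}$-tableaux $\mathfrak{t}$ on which, for $1\le i\le n$, $L_i=q^{1-i}T_{i-1}\cdots T_1T_0T_1\cdots T_{i-1}$ acts by the scalar $Q_cq^{b-a}$, where $(a,b,c)$ (row $a$, column $b$, component $c$) is the node containing $i$ in $\mathfrak{t}$. $V^{\boldsymbol{\lambda}}$ denotes an $\mathcal{H}$-module, free of finite rank over $A$, with $K\otimes_AV^{\boldsymbol{\lambda}}\simeq KV^{\boldsymbol{\lambda}}$. The one dimensional ones are: $((n),\emptyset)$ and $(\emptyset,(n))$, with $T_i\mapsto q$ for $i\ge1$ and $T_0\mapsto Q_1$, resp. $Q_2$; $((1^n),\emptyset)$ and $(\emptyset,(1^n))$, with $T_i\mapsto-1$ for $i\ge1$ and $T_0\mapsto Q_1$, resp. $Q_2$. **Specialization.** Let $\eta\in\mathbb{C}$ be a primitive $e$-th root of $1$; $\theta_{\mathbf{s}}:A\to\mathbb{C}$ sends $q\mapsto\eta$, $Q_j\mapsto\eta^{s_j}$. $\mathbb{C}_{\theta_{\mathbf{s}}}\mathcal{H}$ and $\mathbb{C}_{\theta_{\mathbf{s}}}V^{\boldsymbol{\lambda}}$ are the specializations; $[\mathbb{C}_{\theta_{\mathbf{s}}}V^{\boldsymbol{\lambda}}:M]$ is the composition multiplicity of a simple module $M$ (independent of the choice of $V^{\boldsymbol{\lambda}}$). **Labels of simple modules.** Choose rationals $v_1<v_2<v_1+e$ and put $m_j=s_j-v_j$. For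 $\boldsymbol{\lambda}\vdash_2 n$ let $\kappa_1(\boldsymbol{\lambda})\ge\kappa_2(\boldsymbol{\lambda})\ge\cdots$ be the elements of the multiset $\{\lambda^c_a-a+m_c\mid c\in\{1,2\},\ a\ge1\}$ in weakly decreasing order. Write $\boldsymbol{\mu}\ll\boldsymbol{\lambda}$ if $\boldsymbol{\mu}=\boldsymbol{\lambda}$, or if $\kappa(\boldsymbol{\mu})\ne\kappa(\boldsymbol{\lambda})$ and $\sum_{i\le t}\kappa_i(\boldsymbol{\mu})\le\sum_{i\le t}\kappa_i(\boldsymbol{\lambda})$ for all $t\ge1$. It is known that for each simple $\mathbb{C}_{\theta_{\mathbf{s}}}\mathcal{H}$-module $M$ there is a unique $\boldsymbol{\lambda}_M\vdash_2 n$ with $[\mathbb{C}_{\theta_{\mathbf{s}}}V^{\boldsymbol{\lambda}_M}:M]=1$ and such that $[\mathbb{C}_{\theta_{\mathbf{s}}}V^{\boldsymbol{\mu}}:M]\ne0$ implies $\boldsymbol{\mu}\ll\boldsymbol{\lambda}_M$; moreover $M\mapsto\boldsymbol{\lambda}_M$ is injective and does not depend on the choice of the $v_j$. If $V^{\boldsymbol{\lambda}}$ is one dimensional, $\boldsymbol{\lambda}_{\theta_{\mathbf{s}}}:=\boldsymbol{\lambda}_M$ for the simple module $M=\mathbb{C}_{\theta_{\mathbf{s}}}V^{\boldsymbol{\lambda}}$. *)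

(* Defs.v *)
From HB Require Import structures.
From mathcomp Require Import all_boot all_order all_algebra.
From mathcomp Require Import boolp classical_sets reals.
From mathcomp Require Import complex.
From mathcomp Require Import mpoly.

Set Implicit Arguments.
Unset Strict Implicit.
Unset Printing Implicit Defensive.

Import Order.TTheory GRing.Theory Num.Theory.
Local Open Scope ring_scope.

(* F(q, Q_1, Q_2), with q = 'X_0, Q_1 = 'X_1 and Q_2 = 'X_2 *)
Notation ratfun F := {fraction {mpoly F[3]}}.

Local Notation "x %:F" := (FracField.tofrac x).

Section Laurent.
Variable F : fieldType.

(* F[q^{+-1}, Q_1, Q_2] as the subring of the fractions p / q^k, p polynomial;
   its fraction field is therefore [ratfun F]. *)
Definition laurent_pred : {pred ratfun F} :=
  fun x => `[< exists (p : {mpoly F[3]}) (k : nat), x = p%:F / ('X_0)%:F ^+ k >].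

Lemma laurent_q_neq0 : ('X_0 : {mpoly F[3]})%:F != 0.
Proof.
rewrite tofrac_eq0; apply/eqP => /(congr1 (meval (fun=> 1))).
by rewrite mevalXU meval0; apply/eqP/oner_neq0.
Qed.

Lemma laurent_subring : subring_closed laurent_pred.
Proof.
have q0 := laurent_q_neq0; split.
- by apply/asboolP; exists 1, 0%N; rewrite expr0 divr1 tofrac1.
- move=> x y /asboolP[p [k ->]] /asboolP[p' [k' ->]]; apply/asboolP.
  exists (p * 'X_0 ^+ k' - p' * 'X_0 ^+ k), (k + k')%N.
  rewrite tofracB !tofracM !tofracXn exprD.
  by rewrite -[- (_ / _)]mulNr addf_div ?expf_neq0 // mulNr.
- move=> x y /asboolP[p [k ->]] /asboolP[p' [k' ->]]; apply/asboolP.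
  by exists (p * p'), (k + k')%N; rewrite tofracM exprD mulf_div.
Qed.

HB.instance Definition _ :=
  GRing.isSubringClosed.Build (ratfun F) laurent_pred laurent_subring.

Record laurent := Laurent { lval : ratfun F; _ : lval \in laurent_pred }.

HB.instance Definition _ := [isSub for lval].
HB.instance Definition _ := [Choice of laurent by <:].
HB.instance Definition _ := [SubChoice_isSubComNzRing of laurent by <:].

Lemma laurent_polyP (p : {mpoly F[3]}) : p%:F \in laurent_pred.
Proof. by apply/asboolP; exists p, 0%N; rewrite expr0 divr1. Qed.

Definition laurent_of_poly (p : {mpoly F[3]}) : laurent :=
  Laurent (laurent_polyP p).

Definition lq : laurent := laurent_of_poly 'X_0.
Definition lQ : laurent * laurent :=
  (laurent_of_poly 'X_1, laurent_of_poly 'X_(2 : 'I_3)).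

Section Evaluation.
Variables (x : F) (y : F * F).
Hypothesis x_neq0 : x != 0.

Let pt (i : 'I_3) : F := nth 0 [:: x; y.1; y.2] i.

Lemma laurent_repr (a : laurent) :
  exists pk : {mpoly F[3]} * nat, lval a = pk.1%:F / ('X_0)%:F ^+ pk.2.
Proof. by case: a => a /= /asboolP[p [k e]]; exists (p, k). Qed.

(* The morphism of F-algebras q |-> x, (Q_1, Q_2) |-> y: an element p / q^k is
   sent to p(x, y) / x^k (see [laurent_evalE]). *)
Definition laurent_eval of x != 0 := fun a : laurent =>
  let pk := projT1 (cid (laurent_repr a)) in pk.1.@[pt] / x ^+ pk.2.

Lemma laurent_evalE (a : laurent) (p : {mpoly F[3]}) (k : nat) :
  lval a = p%:F / ('X_0)%:F ^+ k ->
  laurent_eval x_neq0 a = p.@[pt] / x ^+ k.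
Proof.
rewrite /laurent_eval; case: cid => -[p' k'] /= -> /eqP.
rewrite eqr_div ?expf_neq0 ?laurent_q_neq0 // -!tofracXn -!tofracM tofrac_eq.
move=> /eqP /(congr1 (meval pt)); rewrite !mevalM !rmorphXn /= !mevalXU /= => e.
by apply/eqP; rewrite eqr_div ?expf_neq0 //; apply/eqP.
Qed.

Lemma laurent_eval_zmod : zmod_morphism (laurent_eval x_neq0).
Proof.
move=> a b.
have [[p k] /= ea] := laurent_repr a; have [[p' k'] /= eb] := laurent_repr b.
rewrite (laurent_evalE ea) (laurent_evalE eb).
rewrite (@laurent_evalE _ (p * 'X_0 ^+ k' - p' * 'X_0 ^+ k) (k + k')).
  rewrite mevalB !mevalM !rmorphXn /= !mevalXU /= exprD.
  by rewrite -[- (_ / _)]mulNr addf_div ?expf_neq0 // mulNr.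
rewrite -[lval _]/(lval a - lval b) ea eb tofracB !tofracM !tofracXn exprD.
by rewrite -[- (_ / _)]mulNr addf_div ?expf_neq0 ?laurent_q_neq0 // mulNr.
Qed.

Lemma laurent_eval_monoid : monoid_morphism (laurent_eval x_neq0).
Proof.
split; first by rewrite (@laurent_evalE _ 1 0) ?meval1 ?expr0 ?divr1 ?tofrac1.
move=> a b.
have [[p k] /= ea] := laurent_repr a; have [[p' k'] /= eb] := laurent_repr b.
rewrite (laurent_evalE ea) (laurent_evalE eb).
rewrite (@laurent_evalE _ (p * p') (k + k')).
  by rewrite mevalM exprD mulf_div.
by rewrite -[lval _]/(lval a * lval b) ea eb tofracM exprD mulf_div.
Qed.

HB.instance Definition _ :=
  GRing.isZmodMorphism.Build laurent F (laurent_eval x_neq0) laurent_eval_zmod.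
HB.instance Definition _ :=
  GRing.isMonoidMorphism.Build laurent F (laurent_eval x_neq0)
    laurent_eval_monoid.

Lemma laurent_eval_poly (p : {mpoly F[3]}) :
  laurent_eval x_neq0 (laurent_of_poly p) = p.@[pt].
Proof. by rewrite (@laurent_evalE _ p 0) ?expr0 ?divr1. Qed.

Lemma laurent_evalC (c : F) :
  laurent_eval x_neq0 (laurent_of_poly c%:MP) = c.
Proof. by rewrite laurent_eval_poly mevalC. Qed.

Lemma laurent_eval_q : laurent_eval x_neq0 lq = x.
Proof. by rewrite laurent_eval_poly mevalXU. Qed.

Lemma laurent_eval_Q1 : laurent_eval x_neq0 lQ.1 = y.1.
Proof. by rewrite laurent_eval_poly mevalXU. Qed.

Lemma laurent_eval_Q2 : laurent_eval x_neq0 lQ.2 = y.2.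
Proof. by rewrite laurent_eval_poly mevalXU. Qed.

End Evaluation.
End Laurent.

Arguments laurent_eval {F x} y x_neq0 _.

(* The relations of the Hecke algebra of type B_n with parameters q, Q_1, Q_2,
   for matrices T 0, ..., T (n - 1). *)
Record hecke_relations (n : nat) (S : comNzRingType) (q : S) (Q : S * S)
    (d : nat) (T : 'I_n -> 'M[S]_d) : Prop := HeckeRelations {
  hecke_quad0 : forall i : 'I_n, i = 0%N :> nat ->
    (T i - Q.1%:M) *m (T i - Q.2%:M) = 0;
  hecke_quad : forall i : 'I_n, (0 < i)%N ->
    (T i - q%:M) *m (T i + 1%:M) = 0;
  hecke_braid0 : forall i j : 'I_n, i = 0%N :> nat -> j = 1%N :> nat ->
    T i *m T j *m T i *m T j = T j *m T i *m T j *m T i;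
  hecke_braid : forall i j : 'I_n, (0 < i)%N -> j = i.+1 :> nat ->
    T i *m T j *m T i = T j *m T i *m T j;
  hecke_comm : forall i j : 'I_n, (i.+2 <= j)%N ->
    T i *m T j = T j *m T i }.

(* A module, free of finite rank over S, over the Hecke algebra over S, given by
   the matrices of the generators in a basis. Matrices act on row vectors, T_i v
   being v *m T i; as the set of relations is stable under reversal of words,
   this describes left modules. *)
Record heckeModule (n : nat) (S : comNzRingType) (q : S) (Q : S * S) :=
  HeckeModule {
    hrank : nat;
    hgen :> 'I_n -> 'M[S]_hrank;
    hgenP : hecke_relations q Q hgen }.

Section BaseChange.
Variables (S S' : comNzRingType) (f : {rmorphism S -> S'}).
Variables (n : nat) (q : S) (Q : S * S) (V : heckeModule n q Q).

Lemma base_change_relations :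
  hecke_relations (f q) (f Q.1, f Q.2) (fun i => map_mx f (V i)).
Proof.
case: (hgenP V) => hT0 hTi hT01 hbraid hcomm; split=> /=.
- move=> i /hT0 /(congr1 (map_mx f)).
  by rewrite map_mxM !map_mxB !map_scalar_mx map_mx0.
- move=> i /hTi /(congr1 (map_mx f)).
  by rewrite map_mxM map_mxB map_mxD !map_scalar_mx rmorph1 map_mx0.
- by move=> i j hi hj; rewrite -!map_mxM hT01.
- by move=> i j hi hj; rewrite -!map_mxM hbraid.
- by move=> i j hij; rewrite -!map_mxM hcomm.
Qed.

(* S' (x)_S V *)
Definition base_change : heckeModule n (f q) (f Q.1, f Q.2) :=
  HeckeModule base_change_relations.

End BaseChange.

Section FieldModules.
Variables (F : fieldType) (n : nat) (q : F) (Q : F * F).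
Implicit Types V M : heckeModule n q Q.

(* As in mxalgebra, a subspace is the row space of a matrix. *)
Definition hstable V (U : 'M[F]_(hrank V)) : Prop :=
  forall i, stablemx U (V i).

Definition hsimple V : Prop :=
  (0 < hrank V)%N /\ forall U, @hstable V U -> U = 0 \/ row_full U.

(* U < W are submodules and W / U is simple. *)
Definition hcover V (U W : 'M[F]_(hrank V)) : Prop :=
  [/\ hstable U, hstable W, (U < W)%MS &
      forall X, @hstable V X -> (U <= X <= W)%MS ->
        (X <= U)%MS \/ (W <= X)%MS].

(* [:: W_1; ...; W_k] stands for 0 = W_0 < W_1 < ... < W_k = V. *)
Definition composition_series V (s : seq 'M[F]_(hrank V)) : Prop :=
  (forall UW, UW \in zip (0 :: s) s -> hcover UW.1 UW.2)
  /\ row_full (last 0 s).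

(* W / U and M are isomorphic: X induces a surjective morphism from W to M,
   with kernel U. *)
Definition factor_iso V M (U W : 'M[F]_(hrank V)) : Prop :=
  exists X : 'M[F]_(hrank V, hrank M),
    [/\ forall i, W *m V i *m X = W *m X *m M i,
        row_full (W *m X) & (W :&: kermx X == U)%MS].

(* [V : M]; the composition series used is immaterial, by Jordan-Hoelder. *)
Definition comp_mult V M : nat :=
  count (fun UW => `[< factor_iso M UW.1 UW.2 >])
    (let s := xget [::] [set s | @composition_series V s] in zip (0 :: s) s).

End FieldModules.

(* Pairs of partitions, without zero parts. *)
Definition bipart := (seq nat * seq nat)%type.

Definition is_part (l : seq nat) : bool :=
  sorted geq l && all (fun k => 0 < k)%N l.

Definition is_bipart (n : nat) (lam : bipart) : bool :=
  [&& is_part lam.1, is_part lam.2 & sumn lam.1 + sumn lam.2 == n]%N.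

(* Components are indexed by bool: false for the first, true for the second. *)
Definition comp {T : Type} (p : T * T) (c : bool) : T := if c then p.2 else p.1.

Definition part (lam : bipart) (c : bool) (a : nat) : nat :=
  nth 0%N (comp lam c) a.

(* Tableaux of size n: t i = (a, b, c) is the node containing i + 1, the row a,
   the column b and the entry i being counted from 0. *)
Definition tableau (n : nat) := {ffun 'I_n -> 'I_n * 'I_n * bool}.

Section Tableaux.
Variable n : nat.
Implicit Type t : tableau n.

Definition trow t i : 'I_n := (t i).1.1.
Definition tcol t i : 'I_n := (t i).1.2.
Definition tcomp t i : bool := (t i).2.

(* For a 2-partition lam of n, an injective filling of the diagram of lam by n
   entries is bijective. *)
Definition std_tableaux (lam : bipart) : {set tableau n} :=
  [set t : tableau n |
    [&& injectiveb t,
        [forall i, tcol t i < part lam (tcomp t i) (trow t i)],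
        [forall i, forall j,
           [&& tcomp t i == tcomp t j, trow t i == trow t j &
               tcol t i < tcol t j] ==> (i < j)] &
        [forall i, forall j,
           [&& tcomp t i == tcomp t j, tcol t i == tcol t j &
               trow t i < trow t j] ==> (i < j)]]%N].

End Tableaux.

Section GenericSimple.
Variables (F : fieldType) (n : nat) (q : F) (Q : F * F).

(* L_{i+1} = q^{-i} T_i ... T_1 T_0 T_1 ... T_i *)
Definition jucys_murphy (V : heckeModule n q Q) (i : 'I_n) : 'M[F]_(hrank V) :=
  q ^- i *: ((\big[mulmx/1%:M]_(j <- rev (enum 'I_n) | (j <= i)%N) V j)
             *m \big[mulmx/1%:M]_(j < n | (0 < j <= i)%N) V j).

Definition residue (t : tableau n) (i : 'I_n) : F :=
  comp Q (tcomp t i) * q ^ ((tcol t i)%:Z - (trow t i)%:Z).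

(* W is (isomorphic to) the simple module indexed by lam: the rows of B are a
   basis of W indexed by the standard lam-tableaux. *)
Definition is_simple_at (lam : bipart) (W : heckeModule n q Q) : Prop :=
  hsimple W /\
  exists B : 'M[F]_(#|std_tableaux n lam|, hrank W),
    [/\ row_free B, row_full B &
        forall k i, row k B *m jucys_murphy W i
                    = residue (enum_val k) i *: row k B].

End GenericSimple.

(* V is an A-form V^lam: K (x)_A V is the simple module indexed by lam. *)
Definition is_form (F : fieldType) (n : nat) (lam : bipart)
    (V : heckeModule n (lq F) (lQ F)) : Prop :=
  is_simple_at lam (base_change (val : laurent F -> ratfun F) V).

Lemma prim_root_neq0 (F : fieldType) (e : nat) (z : F) :
  e.-primitive_root z -> z != 0.
Proof.
move=> hz; have := prim_expr_order hz; have := prim_order_gt0 hz.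
case: eqP => // -> e0 /eqP; rewrite expr0n eqn0Ngt e0 /=.
by rewrite eq_sym oner_eq0.
Qed.

Section Labels.
Variables (F : fieldType) (n e : nat) (eta : F).
Hypothesis heta : e.-primitive_root eta.
Variables (s : int * int) (v : rat * rat).

(* theta_s : q |-> eta, Q_j |-> eta^{s_j} *)
Definition theta := laurent_eval (eta ^ s.1, eta ^ s.2) (prim_root_neq0 heta).

Definition specialize (V : heckeModule n (lq F) (lQ F)) := base_change theta V.

(* lam^c_a - a + m_c, where m_c = s_c - v_c; here the row a starts from 0. *)
Definition beta (lam : bipart) (c : bool) (a : nat) : rat :=
  (part lam c a)%:R - a.+1%:R + ((comp s c)%:~R - comp v c).

(* kappa_{i+1}. As beta lam c a is strictly decreasing in a, the i + 1 largest
   elements of the multiset occur in the rows a <= i of the two components. *)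
Definition kappa (lam : bipart) (i : nat) : rat :=
  nth 0 (sort >=%R [seq beta lam c a | c <- [:: false; true], a <- iota 0 i.+1])
      i.

(* mu << lam *)
Definition ll (mu lam : bipart) : Prop :=
  mu = lam \/
  (kappa mu <> kappa lam /\
   forall t : nat, (1 <= t)%N ->
     \sum_(i < t) kappa mu i <= \sum_(i < t) kappa lam i).

Variable V : bipart -> heckeModule n (lq F) (lQ F).

Definition decomp lam M : nat := comp_mult (specialize (V lam)) M.

Definition is_label M (lam : bipart) : Prop :=
  [/\ is_bipart n lam, decomp lam M = 1%N &
      forall mu, is_bipart n mu -> decomp mu M <> 0%N -> ll mu lam].

(* lam_theta = lam' *)
Definition theta_label (lam lam' : bipart) : Prop :=
  unique (is_label (specialize (V lam))) lam'.

End Labels.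

(* ((k+1)^r, k^{e-1-r}) with n = k(e-1) + r and 0 <= r <= e-2; the parts equal
   to k are removed when k = 0. *)
Definition mullineux_row (e n : nat) : seq nat :=
  let k := (n %/ e.-1)%N in let r := (n %% e.-1)%N in
  [seq p <- nseq r k.+1 ++ nseq (e.-1 - r) k | 0 < p]%N.

(* Main.v *)
Require Import Defs.
From HB Require Import structures.
From mathcomp Require Import all_boot all_order all_algebra.
From mathcomp Require Import boolp classical_sets reals complex.
From mathcomp Require Import zify ring lra.

(** If [V^mu : M] <> 0 for a one dimensional M, then, by specializing the product over
    the standard mu-tableaux t of L_(i_t) - res_t(i_t), which vanishes generically, the
    eigenvalues of the Jucys-Murphy elements on M are the residues along some standard
    mu-tableau t. For the sign these residues are s, s - 1, s - 2, ..., and an induction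
    on the entries bounds the content of i = k (e - 1) + r in t by k - r, which is its
    content in the tableau of shape (m_e(n), 0) filled column by column. Dominance
    follows, since sum_a max(beta_a - x, 0) is, up to a constant, a sum over the nodes
    of a nondecreasing function of the content.

    This residue sequence belongs to a single tableau of shape (m_e(n), 0), so the
    generic projector onto its line specializes to a matrix of rank one, and exactly one
    composition factor D of the specialized module contains an eigenvector w for it.
    The space of w in D is obtained by passing successively to eigenspaces of
    L_n, L_(n-1), ..., each of which is simple for the smaller Hecke algebra because
    L_(m-1) and L_m never share the eigenvalue in question; going back up, the
    braid relations force T_i w = - w, so D is the sign. *)

Set Implicit Arguments.
Unset Strict Implicit.
Unset Printing Implicit Defensive.

Import Order.TTheory GRing.Theory Num.Theory.
Local Open Scope ring_scope.

(* [ssrfun.comp] is imported after Defs and hides the projection of this name. *)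
Local Notation comp := Defs.comp.

(** * Standard tableaux *)

Section Shapes.
Variable n : nat.
Implicit Types (lam mu : bipart) (t : tableau n).

(** The forms V^mu are arbitrary, so the only handle on them is the generic spectrum of the
    Jucys-Murphy elements. Facts about a specialization come from identities proved over the
    fraction field and pulled back along the injection of the base ring. Hence the scaling of L_i by
    q^n, and the use of 2 x 2 minors and a trace, rather than a rank, for the projector.

    After specialization the L_i need not be diagonalizable, so residues alone do not show that D is
    one dimensional; the relations have to be used. This becomes a type A question because in every
    standard tableau of shape (m_e(n), 0) the smallest entry lies in the first component, so that
    T_0 acts by a scalar.

    The column height e - 1 comes from the sign residues, which drop by 1 at each entry. Column k,
    counted from 0, carries the contents k, k - 1, ..., k - e + 2, and the next residue k - e + 1
    equals k + 1 modulo e, the content at the top of the next column.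

    Since s_1 = s_2, both Q_1 and Q_2 specialize to the same scalar, so the two characters in each
    pair become equal. *)

Definition nodes lam : {set 'I_n * 'I_n * bool} :=
  [set x : 'I_n * 'I_n * bool | (x.1.2 < part lam x.2 x.1.1)%N].

Lemma is_part_size l : is_part l -> (size l <= sumn l)%N.
Proof.
case/andP=> _; elim: l => //= x l IH /andP[x0 /IH]; lia.
Qed.

Lemma nth_le_sumn l a : (nth 0 l a <= sumn l)%N.
Proof. by elim: l a => [|x l IH] [|a] //=; [lia | have := IH a; lia]. Qed.

Lemma is_part_nth l a b : is_part l -> (a <= b)%N -> (nth 0 l b <= nth 0 l a)%N.
Proof.
case/andP=> hs _ hab; have [hb|hb] := ltnP b (size l); last first.
  by rewrite nth_default.
have geq_trans : transitive geq by move=> x y z /=; lia.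
have geq_refl : reflexive geq by move=> x /=; lia.
have := sorted_leq_nth geq_trans geq_refl 0%N hs.
by apply; rewrite ?inE //; lia.
Qed.

Lemma bipart_comp lam c : is_bipart n lam ->
  is_part (comp lam c) /\ (sumn (comp lam c) <= n)%N.
Proof. by case/and3P=> h1 h2 /eqP <-; case: c => /=; split=> //; lia. Qed.

Lemma part_le_size lam c a : is_bipart n lam -> (part lam c a <= n)%N.
Proof.
move=> /(bipart_comp c)[_]; apply: leq_trans; exact: nth_le_sumn.
Qed.

Lemma part_default lam c a : is_bipart n lam -> (n <= a)%N -> part lam c a = 0%N.
Proof.
move=> /(bipart_comp c)[/is_part_size h1 h2] ha; apply: nth_default; lia.
Qed.

Lemma part_decr lam c a b : is_bipart n lam -> (a <= b)%N ->
  (part lam c b <= part lam c a)%N.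
Proof. by move=> /(bipart_comp c)[h _]; apply: is_part_nth. Qed.

Lemma sum_nodes (A : nmodType) lam (G : nat -> nat -> bool -> A) :
  is_bipart n lam ->
  \sum_(x in nodes lam) G x.1.1 x.1.2 x.2 =
  \sum_(c : bool) \sum_(a < n) \sum_(b < part lam c a) G a b c.
Proof.
move=> hlam.
rewrite [RHS](eq_bigr (fun c => \sum_(p : 'I_n * 'I_n | (p.2 < part lam c p.1)%N)
    G p.1 p.2 c)); last first.
  move=> c _; rewrite -[RHS](@pair_big_dep A 0 _ _ _ xpredT
    (fun a b : 'I_n => (b < part lam c a)%N) (fun a b => G a b c)).
  apply: eq_bigr => a _.
  by rewrite (big_ord_widen n (fun b => G a b c)) // part_le_size.
rewrite (exchange_big_dep xpredT) //= pair_big_dep /=.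
by apply: eq_bigl => x; rewrite inE.
Qed.

Lemma card_nodes lam : is_bipart n lam -> #|nodes lam| = n.
Proof.
move=> hlam; rewrite -sum1_card.
rewrite (@sum_nodes nat _ (fun _ _ _ => 1%N)) //.
have E c : (\sum_(a < n) part lam c a)%N = sumn (comp lam c).
  have [/is_part_size h1 h2] := bipart_comp c hlam.
  rewrite sumnE (big_nth 0%N) big_mkord.
  rewrite [RHS](big_ord_widen n (fun a => part lam c a)); last by lia.
  rewrite [RHS]big_mkcond /=; apply: eq_bigr => a _.
  by case: ltnP => // ha; rewrite /part nth_default.
rewrite (eq_bigr (fun c => sumn (comp lam c))); last first.
  move=> c _; rewrite -E; apply: (@eq_bigr nat 0%N addn) => a _.
  by rewrite (@big_const_ord nat 0%N addn) iter_addn_0 mul1n.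
by rewrite big_bool /=; case/and3P: hlam => _ _ /eqP /= <-; rewrite addrC.
Qed.

Lemma stdP t lam : t \in std_tableaux n lam ->
  [/\ injective t, forall i, (tcol t i < part lam (tcomp t i) (trow t i))%N,
      forall i j, tcomp t i = tcomp t j -> trow t i = trow t j ->
        (tcol t i < tcol t j)%N -> (i < j)%N &
      forall i j, tcomp t i = tcomp t j -> tcol t i = tcol t j ->
        (trow t i < trow t j)%N -> (i < j)%N].
Proof.
rewrite inE => /and4P[/injectiveP h1 /forallP h2 /forallP h3 /forallP h4].
split=> // i j hc hr hlt.
  by have /forallP/(_ j)/implyP := h3 i; apply; rewrite hc hr !eqxx.
by have /forallP/(_ j)/implyP := h4 i; apply; rewrite hc hr !eqxx.
Qed.

Lemma std_image t lam : is_bipart n lam -> t \in std_tableaux n lam ->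
  t @: [set: 'I_n] = nodes lam.
Proof.
move=> hlam /stdP[inj hin _ _]; apply/eqP; rewrite eqEcard card_nodes //.
rewrite card_imset // cardsT card_ord leqnn andbT.
by apply/fintype.subsetP=> x /imsetP[i _ ->]; rewrite inE; apply: hin.
Qed.

Lemma std_fill t lam (a b : 'I_n) c : is_bipart n lam ->
  t \in std_tableaux n lam -> (b < part lam c a)%N ->
  exists i, t i = (a, b, c).
Proof.
move=> hlam ht hb; have : (a, b, c) \in nodes lam by rewrite inE.
by rewrite -(std_image hlam ht) => /imsetP[i _ ->]; exists i.
Qed.

Lemma sum_tableau (A : nmodType) t lam (G : nat -> nat -> bool -> A) :
  is_bipart n lam -> t \in std_tableaux n lam ->
  \sum_i G (trow t i) (tcol t i) (tcomp t i) =
  \sum_(c : bool) \sum_(a < n) \sum_(b < part lam c a) G a b c.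
Proof.
move=> hlam ht; rewrite -sum_nodes // -(std_image hlam ht) big_imset /=; last first.
  by move=> i j _ _; have [inj _ _ _] := stdP ht; apply: inj.
by apply: eq_bigl => i; rewrite inE.
Qed.

Lemma tableau_eta t i : t i = (trow t i, tcol t i, tcomp t i).
Proof. by rewrite /trow /tcol /tcomp; case: (t i) => [[]]. Qed.

(** Goes through the node in row [a] and the column of [i], which lies in the diagram because parts
    decrease: along row [a] from [j] to it, then down the column to [i]. *)
Lemma std_below t lam i (a b : 'I_n) : is_bipart n lam ->
  t \in std_tableaux n lam -> (a <= trow t i)%N -> (b <= tcol t i)%N ->
  exists2 j : 'I_n, t j = (a, b, tcomp t i) &
    (j <= i)%N /\ ((a < trow t i)%N || (b < tcol t i)%N -> (j < i)%N).
Proof.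
move=> hlam ht ha hb; have [inj hin hrow hcol] := stdP ht.
have hi := hin i; have hp := part_decr (tcomp t i) hlam ha.
have [j hj] : exists j, t j = (a, b, tcomp t i) by apply: (std_fill hlam ht); lia.
have [k hk] : exists k, t k = (a, tcol t i, tcomp t i).
  by apply: (std_fill hlam ht); lia.
exists j => //.
have e1 : trow t j = a by rewrite /trow hj.
have e2 : tcol t j = b by rewrite /tcol hj.
have e3 : tcomp t j = tcomp t i by rewrite {1}/tcomp hj.
have f1 : trow t k = a by rewrite /trow hk.
have f2 : tcol t k = tcol t i by rewrite {1}/tcol hk.
have f3 : tcomp t k = tcomp t i by rewrite {1}/tcomp hk.
have k1 : (a < trow t i)%N -> (k < i)%N.
  by move=> h; apply: hcol; rewrite ?f3 ?f2 ?f1.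
have k2 : (trow t i <= a)%N -> k = i.
  move=> h; apply: inj; rewrite hk (tableau_eta t i); congr (_, _, _).
  by apply: val_inj => /=; lia.
have j1 : (b < tcol t i)%N -> (j < k)%N.
  by move=> h; apply: hrow; rewrite ?e3 ?f3 ?e1 ?f1 ?e2 ?f2.
have j2 : (tcol t i <= b)%N -> j = k.
  move=> h; apply: inj; rewrite hj hk; congr (_, _, _).
  by apply: val_inj => /=; lia.
have := k1; have := j1.
case: (ltnP a (trow t i)) => [_|/k2 ek]; case: (ltnP b (tcol t i)) => [_|/j2 ej] /=;
  rewrite ?ek ?ej ?ek //; lia.
Qed.

(* The position of the entry i on its diagonal is the number of smaller entries
   of the same content and component. *)
Lemma std_content_inj t t' lam mu : is_bipart n lam -> is_bipart n mu ->
  t \in std_tableaux n lam -> t' \in std_tableaux n mu ->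
  (forall i, tcomp t i = tcomp t' i) ->
  (forall i, tcol t i + trow t' i = tcol t' i + trow t i)%N -> t = t'.
Proof.
move=> hlam hmu ht ht' hc hd; apply/ffunP => i.
have [m] := ubnP (i : nat); elim: m i => // m IH i; rewrite ltnS => him.
have one s s' nu nu' : is_bipart n nu -> is_bipart n nu' ->
  s \in std_tableaux n nu -> s' \in std_tableaux n nu' ->
  (forall i, tcomp s i = tcomp s' i) ->
  (forall i, tcol s i + trow s' i = tcol s' i + trow s i)%N ->
  (forall j : 'I_n, (j < m)%N -> s j = s' j) -> (trow s i <= trow s' i)%N.
  move=> hnu hnu' hs hs' hsc hsd hIH; case: leqP => // hlt.
  have hlt2 : (tcol s' i < tcol s i)%N by have := hsd i; lia.
  have [j hj [_ hji]] := std_below hnu hs (ltnW hlt) (ltnW hlt2).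
  have {}hji : (j < i)%N by apply: hji; rewrite hlt.
  have [inj _ _ _] := stdP hs'.
  have /inj ij : s' j = s' i.
    by rewrite -hIH ?hj ?(leq_trans hji) // hsc -tableau_eta.
  by rewrite ij ltnn in hji.
have h1 := one t t' lam mu hlam hmu ht ht' hc hd IH.
have h2 : (trow t' i <= trow t i)%N.
  apply: (one t' t mu lam) => // j hj.
  by rewrite IH.
have e1 : trow t i = trow t' i by apply: val_inj => /=; lia.
have e2 : tcol t i = tcol t' i by apply: val_inj => /=; have := hd i; rewrite e1; lia.
by rewrite !tableau_eta e1 e2 hc.
Qed.

Lemma std_shape_inj t lam mu : is_bipart n lam -> is_bipart n mu ->
  t \in std_tableaux n lam -> t \in std_tableaux n mu -> lam = mu.
Proof.
move=> hlam hmu hl hm.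
have E := etrans (esym (std_image hlam hl)) (std_image hmu hm).
have P c a : part lam c a = part mu c a.
  have [ha|ha] := ltnP a n; last by rewrite !part_default.
  have le nu nu' : is_bipart n nu -> nodes nu = nodes nu' ->
      (part nu c a <= part nu' c a)%N.
    move=> hnu En; case eb: (part nu c a) (part_le_size c a hnu) => [|b] // hb.
    have : (Ordinal ha, Ordinal hb, c) \in nodes nu by rewrite inE /= eb.
    by rewrite En inE.
  by apply/eqP; rewrite eqn_leq !le.
have Q c : comp lam c = comp mu c.
  have [/andP[_ pl] _] := bipart_comp c hlam.
  have [/andP[_ pm] _] := bipart_comp c hmu.
  have sz l l' : (forall a, nth 0 l a = nth 0 l' a)%N -> all (fun k => 0 < k)%N l ->
      (size l <= size l')%N.
    move=> hn /all_nthP hp; case: leqP => // h.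
    by have := hp 0%N _ h; rewrite hn nth_default.
  apply: (@eq_from_nth _ 0%N) => [|a _]; last exact: P.
  by apply/eqP; rewrite eqn_leq; apply/andP; split; apply: sz => // a;
    [exact: P | exact/esym/P].
by have := Q true; have := Q false; case: (lam) (mu) => [? ?] [? ?] /= -> ->.
Qed.

Lemma std_col_le t lam i : is_bipart n lam -> t \in std_tableaux n lam ->
  (tcol t i <= i)%N.
Proof.
move=> hlam ht; have [m] := ubnP (i : nat); elim: m i => // m IH i.
rewrite ltnS => him; case: (posnP (tcol t i)) => [-> //|hpos].
have hb : ((tcol t i).-1 < n)%N by have := ltn_ord (tcol t i); lia.
have [j hj [_ hji]] := std_below (a := trow t i) (b := Ordinal hb) hlam ht
  (leqnn _) (leq_pred _).
have {}hji : (j < i)%N by apply: hji => /=; lia.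
have := IH j (leq_trans hji him).
by rewrite {1}/tcol hj /=; lia.
Qed.

Lemma std_entry0 t lam (i : 'I_n) : is_bipart n lam -> t \in std_tableaux n lam ->
  i = 0%N :> nat -> tcol t i = 0%N :> nat /\ trow t i = 0%N :> nat.
Proof.
move=> hlam ht hi0; have h0 : (0 < n)%N by have := ltn_ord i; lia.
have [j _ [_ hji]] := std_below (a := Ordinal h0) (b := Ordinal h0) (i := i) hlam ht
  (leq0n _) (leq0n _).
move: hji; rewrite /= hi0; lia.
Qed.

End Shapes.

(** * The tableau of the sign character *)

Section SignTableau.
Variables (n e : nat).
Hypotheses (n_gt0 : (0 < n)%N) (e_gt1 : (1 < e)%N).

Definition sgn_shape : bipart := (mullineux_row e n, [::]).

Lemma mullineux_row_nth a : nth 0%N (mullineux_row e n) a =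
  if (a < n %% e.-1)%N then (n %/ e.-1).+1 else
  if (a < e.-1)%N then (n %/ e.-1)%N else 0%N.
Proof.
rewrite /mullineux_row; set k := (n %/ _)%N; set r := (n %% _)%N.
have hr : (r < e.-1)%N by rewrite /r ltn_mod; lia.
rewrite filter_cat !filter_nseq /= mul1n nth_cat size_nseq nth_nseq.
rewrite nth_nseq; case: (ltnP a r) => h1 //.
 have [->|k0] := posnP k; first by rewrite mul0n; case: ltnP; case: ltnP.
by rewrite mul1n; case: ltnP => h2; case: ltnP => h3 //; lia.
Qed.

Lemma sgn_shape_bipart : is_bipart n sgn_shape.
Proof.
rewrite /is_bipart; apply/and3P; split=> //=; last first.
  rewrite addn0.
  rewrite /mullineux_row; set k := (n %/ _)%N; set r := (n %% _)%N.
  have hr : (r < e.-1)%N by rewrite /r ltn_mod; lia.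
  have hn := divn_eq n e.-1; rewrite -/k -/r in hn.
  rewrite filter_cat !filter_nseq /= mul1n sumn_cat !sumn_nseq.
  case: (posnP k) hn => [->|k0] hn; first by apply/eqP; lia.
  by apply/eqP; rewrite mul1n; nia.
rewrite /is_part /mullineux_row filter_all andbT.
apply: (sorted_filter (leT := geq)); first by move=> x y z /=; lia.
set k := (n %/ _)%N; set r := (n %% _)%N.
have P m x : path geq x (nseq m x) by elim: m => //= m ->; rewrite leqnn.
have Pk m x : (k <= x)%N -> path geq x (nseq m k).
  by case: m => //= m ->; apply: P.
have S m1 m2 : path geq k.+1 (nseq m1 k.+1 ++ nseq m2 k).
  by elim: m1 => [|m1 IH] /=; [apply: Pk | rewrite leqnn].
by case: r => [|r] /=; [case: (_ - _)%N => //= m; apply: P | apply: S].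
Qed.

(** All columns but possibly the last have height e - 1. Numbering column by column gives the node
    (a, b) the number b (e - 1) + a, and the shape consists of the first n numbers. *)
Lemma sgn_shapeP (a b : nat) :
  (b < part sgn_shape false a)%N = (a < e.-1)%N && (b * e.-1 + a < n)%N.
Proof.
rewrite /part /= mullineux_row_nth.
have hr : (n %% e.-1 < e.-1)%N by rewrite ltn_mod; lia.
have hn := divn_eq n e.-1.
move: e.-1 (n %/ _)%N (n %% _)%N hr hn => m k r hr hn.
have [h|[h|h]] : (b < k \/ b = k \/ k.+1 <= b)%N by lia.
- have := leq_mul2r m b.+1 k; rewrite h orbT mulSn => h'.
  by case: (ltnP a r) => ?; case: (ltnP a m) => ?; lia.
- by rewrite h; case: (ltnP a r) => ?; case: (ltnP a m) => ?; lia.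
- have := leq_mul2r m k.+1 b; rewrite h orbT mulSn => h'.
  by case: (ltnP a r) => ?; case: (ltnP a m) => ?; lia.
Qed.

Lemma sgn_row_lt (i : 'I_n) : (i %% e.-1 < n)%N.
Proof. by apply: leq_ltn_trans (ltn_ord i); apply: leq_mod. Qed.

Lemma sgn_col_lt (i : 'I_n) : (i %/ e.-1 < n)%N.
Proof. by apply: leq_ltn_trans (ltn_ord i); apply: leq_div. Qed.

Definition sgn_tableau : tableau n :=
  [ffun i => (Ordinal (sgn_row_lt i), Ordinal (sgn_col_lt i), false)].

Lemma sgn_tableauE i : [/\ trow sgn_tableau i = (i %% e.-1)%N :> nat,
  tcol sgn_tableau i = (i %/ e.-1)%N :> nat & tcomp sgn_tableau i = false].
Proof. by rewrite /trow /tcol /tcomp ffunE. Qed.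

Lemma sgn_tableau_eq i (a b : 'I_n) (c : bool) :
  (sgn_tableau i == (a, b, c)) =
  [&& a < e.-1, i == b * e.-1 + a :> nat & ~~ c]%N.
Proof.
rewrite ffunE; have he : (0 < e.-1)%N by lia.
apply/eqP/idP => [[<- <- <-] /=|/and3P[ha /eqP hi /negbTE ->]].
  by rewrite ltn_mod he andbT /=; apply/eqP; apply: divn_eq.
congr (_, _, _); apply: val_inj => /=; rewrite hi.
  by rewrite modnMDl modn_small.
by rewrite divnMDl // divn_small // addn0.
Qed.

Lemma sgn_tableau_std : sgn_tableau \in std_tableaux n sgn_shape.
Proof.
have he : (0 < e.-1)%N by lia.
rewrite inE; apply/and4P; split.
- apply/injectiveP => i j /eqP; rewrite [sgn_tableau j]ffunE sgn_tableau_eq /=.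
  case/and3P=> _ /eqP h _; apply: val_inj; rewrite /= h; apply/esym; exact: divn_eq.
- apply/forallP => i; have [-> -> ->] := sgn_tableauE i.
  by rewrite sgn_shapeP -divn_eq ltn_mod he ltn_ord.
- apply/forallP => i; apply/forallP => j; apply/implyP => /and3P[_ /eqP/(congr1 val)] /=.
  have [-> -> _] := sgn_tableauE i; have [-> -> _] := sgn_tableauE j.
  have := divn_eq i e.-1; have := divn_eq j e.-1; have := ltn_pmod i he.
  have := ltn_pmod j he.
  move: (i %/ _)%N (j %/ _)%N (i %% _)%N (j %% _)%N; clear; nia.
- apply/forallP => i; apply/forallP => j; apply/implyP => /and3P[_ /eqP/(congr1 val)] /=.
  have [-> -> _] := sgn_tableauE i; have [-> -> _] := sgn_tableauE j.
  have := divn_eq i e.-1; have := divn_eq j e.-1; have := ltn_pmod i he.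
  have := ltn_pmod j he.
  move: (i %/ _)%N (j %/ _)%N (i %% _)%N (j %% _)%N; clear; nia.
Qed.

(* The residue of entry i is minus i modulo e; the shift by n only avoids truncated
   subtraction. *)
Definition sgn_residue (t : tableau n) (i : 'I_n) : Prop :=
  (n + tcol t i - trow t i)%N = (n - i)%N %[mod e].

(** Turns a congruence into an equation without subtraction, a form suited to [nia]. *)
Lemma modn_eq_exists (x y : nat) : x = y %[mod e] ->
  exists p q, (x + p * e = y + q * e)%N.
Proof.
move=> h; exists (y %/ e)%N, (x %/ e)%N.
by rewrite {1}(divn_eq x e) {2}(divn_eq y e) h; lia.
Qed.

(* As i = k (e - 1) + r, the content of entry i is k - r modulo e. *)
Lemma sgn_residueP (t : tableau n) i : sgn_residue t i -> exists p q,
  (tcol t i + i %% e.-1 + p * e = trow t i + i %/ e.-1 + q * e)%N.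
Proof.
move=> /modn_eq_exists[p [q h]]; exists (i %/ e.-1 + p)%N, q.
have := divn_eq i e.-1; have := ltn_ord i; have := ltn_ord (trow t i).
move: h; move: (i %/ _)%N (i %% _)%N => k r; nia.
Qed.

(** Write i = k (e - 1) + r. The left neighbour of [i] is a smaller entry, so by induction its
    content is at most k, and that of [i] is at most k + 1. The latter is k - r modulo e with r <= e
    - 2, so exceeding k - r would make it at least k - r + e >= k + 2. *)
Lemma sgn_content_le lam t i : is_bipart n lam -> t \in std_tableaux n lam ->
  (forall i, sgn_residue t i) ->
  (tcol t i + i %% e.-1 <= trow t i + i %/ e.-1)%N.
Proof.
move=> hlam ht hres; have [m] := ubnP (i : nat); elim: m i => // m IH i.
rewrite ltnS => him.
have he : (0 < e.-1)%N by lia.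
have hr : (i %% e.-1 < e.-1)%N by rewrite ltn_mod.
have hc : (tcol t i <= trow t i + i %/ e.-1 + 1)%N.
  case: (posnP (tcol t i)) => [-> //|hpos].
  have hb : ((tcol t i).-1 < n)%N by have := ltn_ord (tcol t i); lia.
  have [j hj [_ hji]] := std_below (a := trow t i) (b := Ordinal hb) hlam ht
    (leqnn _) (leq_pred _).
  have {}hji : (j < i)%N by apply: hji => /=; lia.
  have := IH j (leq_trans hji him); rewrite /tcol /trow hj /= -/(trow t i) -/(tcol t i).
  have := leq_div2r e.-1 (ltnW hji); lia.
have [p [q]] := sgn_residueP (hres i).
move: (i %/ _)%N (i %% _)%N hr hc => k r hr hc hpq.
case: leqP => // hlt.
have : (p < q)%N by nia.
nia.
Qed.

Lemma sgn_comp t i : t \in std_tableaux n sgn_shape -> tcomp t i = false.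
Proof.
move=> ht; have [_ hin _ _] := stdP ht; have := hin i.
by case: (tcomp t i) => //; rewrite /part /= nth_nil.
Qed.

(** Entry by entry the contents of [t] are bounded by those of [sgn_tableau], and both families have
    the same sum, taken over the nodes of one shape. Hence they agree, and contents determine a
    standard tableau. *)
Lemma sgn_tableau_uniq t : t \in std_tableaux n sgn_shape ->
  (forall i, sgn_residue t i) -> t = sgn_tableau.
Proof.
move=> ht hres; have hs := sgn_shape_bipart; have h0 := sgn_tableau_std.
have hle i := sgn_content_le i hs ht hres.
have H i : (tcol t i + trow sgn_tableau i <= tcol sgn_tableau i + trow t i)%N.
  by have [-> -> _] := sgn_tableauE i; have := hle i; rewrite [(_ %/ _ + _)%N]addnC.
have E : (\sum_i (tcol t i + trow sgn_tableau i) =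
          \sum_i (tcol sgn_tableau i + trow t i))%N.
  have S (u : tableau n) (hu : u \in std_tableaux n sgn_shape) :=
    (@sum_tableau n nat u sgn_shape (fun a b c => a) hs hu,
     @sum_tableau n nat u sgn_shape (fun a b c => b) hs hu).
  rewrite !big_split /= (S t ht).1 (S t ht).2.
  by rewrite (S _ h0).1 (S _ h0).2 addnC.
have EE i : (tcol t i + trow sgn_tableau i = tcol sgn_tableau i + trow t i)%N.
  have := @leqif_sum _ xpredT _ _ _ (fun i _ => leqif_eq (H i)).
  by case=> _; rewrite E eqxx => /esym/forallP/(_ i)/eqP.
apply: (std_content_inj hs hs ht h0) => // i.
by have [_ _ ->] := sgn_tableauE i; apply: sgn_comp.
Qed.

(* The removable nodes of the shape of the entries 0, ..., i of [sgn_tableau] are the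
   node of i and, possibly, the bottom of the previous column. *)
Lemma sgn_corner t (i : 'I_n) : t \in std_tableaux n sgn_shape ->
  (forall j : 'I_n, (i < j)%N -> t j = sgn_tableau j) ->
  (trow t i = i %% e.-1 :> nat /\ tcol t i = i %/ e.-1 :> nat)%N \/
  [/\ (i %% e.-1).+2 < e, trow t i = e.-2 :> nat & (tcol t i).+1 = i %/ e.-1 :> nat]%N.
Proof.
move=> ht hgt; have hs := sgn_shape_bipart.
have [inj hin hrow hcol] := stdP ht.
have he : (0 < e.-1)%N by lia.
have hr : (i %% e.-1 < e.-1)%N by rewrite ltn_mod.
have := hin i; rewrite (sgn_comp i ht) sgn_shapeP => /andP[ha hab].
(* A node whose entry in [t] exceeds [i] is filled as in [sgn_tableau], so its number in the column
   filling exceeds [i]. This is applied to the right and lower neighbours of the node of [i]. *)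
have outer (a b : nat) : (a < e.-1)%N -> (b * e.-1 + a < n)%N ->
    (forall j : 'I_n, trow t j = a :> nat -> tcol t j = b :> nat -> (i < j)%N) ->
    (i < b * e.-1 + a)%N.
  move=> h1 h2 h3.
  have hb : (b < part sgn_shape false a)%N by rewrite sgn_shapeP h1.
  have ha' : (a < n)%N by lia.
  have hb' : (b < n)%N by nia.
  have [j hj] := @std_fill n t sgn_shape (Ordinal ha') (Ordinal hb') false hs ht hb.
  have hij : (i < j)%N by apply: h3; rewrite /trow /tcol hj.
  have := hgt j hij; rewrite hj => /esym/eqP; rewrite sgn_tableau_eq /=.
  by case/and3P=> _ /eqP <- _.
(* Otherwise the entry with that number exceeds [i], hence occupies the node of [i] in [t] too,
   against injectivity. *)
have hle : (tcol t i * e.-1 + trow t i <= i)%N.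
  rewrite leqNgt; apply/negP => hlt.
  have := hgt (Ordinal hab) hlt.
  have /eqP -> : sgn_tableau (Ordinal hab) == t i.
    rewrite (tableau_eta t i) sgn_tableau_eq /= ha eqxx /=.
    by rewrite (sgn_comp i ht).
  by move=> /inj /(congr1 val) /= E; move: hlt; rewrite /= E ltnn.
have h1 : (i < (tcol t i).+1 * e.-1 + trow t i)%N.
  have [hn|hn] := leqP n ((tcol t i).+1 * e.-1 + trow t i).
    exact: leq_trans (ltn_ord i) hn.
  apply: outer => // j e1 e2; apply: hrow; rewrite ?(sgn_comp _ ht) ?e2 //.
  exact: val_inj.
have h2 : (trow t i).+1 = e.-1 \/ (i <= tcol t i * e.-1 + trow t i)%N.
  have [h|h] := leqP e.-1 (trow t i).+1; first by left; lia.
  right; have [hn|hn] := leqP n (tcol t i * e.-1 + (trow t i).+1).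
    by have := ltn_ord i; lia.
  suff : (i < tcol t i * e.-1 + (trow t i).+1)%N by lia.
  apply: outer => // j e1 e2; apply: hcol; rewrite ?(sgn_comp _ ht) ?e1 //.
  exact: val_inj.
have := divn_eq i e.-1.
move: (i %/ _)%N (i %% _)%N hr => k r hr hi.
case: h2 => h2; last first.
  have hb : (nat_of_ord (tcol t i) = k)%N by nia.
  by left; split=> //; nia.
have [h|h] := leqP e.-2 r.
  have hb : (nat_of_ord (tcol t i) = k)%N by nia.
  by left; split=> //; nia.
by right; split; [lia | lia | nia].
Qed.

(** Descending induction on the entries. The two corners allowed by [sgn_corner] have contents k - r
    and k + 1 - e; modulo e they differ by r + 1, which is nonzero, so the residue decides. *)
Lemma sgn_tableau_tail t (i : 'I_n) : t \in std_tableaux n sgn_shape ->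
  (forall j : 'I_n, (i < j)%N -> sgn_residue t j) ->
  forall j : 'I_n, (i < j)%N -> t j = sgn_tableau j.
Proof.
move=> ht hres j.
have [m] := ubnP (n - j)%N; elim: m j => // m IH j; rewrite ltnS => hm hij.
have hgt (k : 'I_n) : (j < k)%N -> t k = sgn_tableau k.
  by move=> hjk; apply: IH; have := ltn_ord k; lia.
have [[e1 e2]|[h1 h2 h3]] := sgn_corner ht hgt.
  have [f1 f2 f3] := sgn_tableauE j.
  rewrite !tableau_eta; congr (_, _, _); last by rewrite f3 (sgn_comp _ ht).
  - by apply: val_inj; rewrite /= e1 f1.
  - by apply: val_inj; rewrite /= e2 f2.
have [p [q]] := sgn_residueP (hres j hij).
move: (j %/ _)%N (j %% _)%N h1 h3 => k r h1 h3 hpq.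
exfalso; have {}hpq : (r.+1 + p * e = q.+1 * e)%N by rewrite mulSn; lia.
have : (p < q.+1)%N by nia.
nia.
Qed.

(** By [sgn_corner] the content of [i] is, modulo e, either - i or k + 1 = - i + r + 1. Subtracting
    the sign residue - (i + 1) of [j] leaves 1 or r + 2, both strictly between 0 and e. *)
Lemma sgn_residue_sep t (i j : 'I_n) : j = i.+1 :> nat ->
  t \in std_tableaux n sgn_shape ->
  (forall k : 'I_n, (i < k)%N -> sgn_residue t k) ->
  ~ (n + tcol t i - trow t i)%N = (n - j)%N %[mod e].
Proof.
move=> hj ht hres /modn_eq_exists[p [q hpq]].
have [[e1 e2]|[h1 h2 h3]] := sgn_corner ht (sgn_tableau_tail ht hres).
  have := divn_eq i e.-1; move: hpq; rewrite e1 e2 hj; have := ltn_ord j.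
  have := ltn_ord i; have : (i %% e.-1 <= i)%N by apply: leq_mod.
  move: (i %/ _)%N (i %% _)%N => k r h0 h1 h2 hpq hi.
  have {}hpq : ((k + p) * e + 1 = q * e)%N by nia.
  have : (k + p < q)%N by nia.
  nia.
have := divn_eq i e.-1; have := ltn_ord j; have := ltn_ord i.
have := ltn_ord (trow t i).
move: (i %/ _)%N (i %% _)%N h1 h3 => k r h1 h3 g1 g2 g3 g4.
have {}hpq : ((k + p) * e + r.+2 = q.+1 * e)%N by nia.
have : (k + p < q.+1)%N by nia.
nia.
Qed.

End SignTableau.

(** * The dominance order *)

Section SortNth.
Implicit Types (u w : seq rat) (x : rat).

Local Notation dsort := (sort >=%R).

Lemma dsort_sorted u : sorted >=%R (dsort u).
Proof. by apply: sort_sorted; apply: ge_total. Qed.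

Lemma dsort_nth_le u i j : (i <= j)%N -> (j < size u)%N ->
  nth 0 (dsort u) j <= nth 0 (dsort u) i.
Proof.
move=> hij hj; apply: (sorted_leq_nth (leT := >=%R) ge_trans ge_refl) => //;
  rewrite ?dsort_sorted ?inE ?size_sort //; exact: leq_ltn_trans hij hj.
Qed.

Lemma dsort_nth_ge u i x : (i < count (>= x) u)%N -> x <= nth 0 (dsort u) i.
Proof.
move=> hc; rewrite leNgt; apply/negP => hlt; move: hc; rewrite ltnNge => /negP; apply.
rewrite -(count_sort >=%R) -(cat_take_drop i (dsort u)) count_cat.
have -> : count (>= x) (drop i (dsort u)) = 0%N.
  apply/eqP; rewrite -leqn0 leqNgt -has_count; apply/negP => /(has_nthP 0)[j].
  rewrite size_drop size_sort nth_drop => hj /=; rewrite leNgt => /negP; apply.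
  by apply: le_lt_trans hlt; apply: dsort_nth_le; rewrite ?leq_addr // -ltn_subRL.
by rewrite addn0 (leq_trans (count_size _ _)) // size_take_min geq_minl.
Qed.

Lemma dsort_nth_cat u w i : (i < size u)%N ->
  (forall x, x \in w -> x <= nth 0 (dsort u) i) ->
  nth 0 (dsort (u ++ w)) i = nth 0 (dsort u) i.
Proof.
move=> hi hw; set s := dsort u in hw *.
have hs : (i < size s)%N by rewrite size_sort.
have E : dsort (u ++ w) = take i.+1 s ++ dsort (drop i.+1 s ++ w).
  apply: (sorted_eq (leT := >=%R) ge_trans ge_anti); first exact: dsort_sorted.
    rewrite (sorted_pairwise ge_trans) pairwise_cat -!(sorted_pairwise ge_trans).
    rewrite dsort_sorted andbT; apply/andP; split; last first.
      by rewrite take_sorted // dsort_sorted.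
    apply/allrelP => x y hx; rewrite mem_sort mem_cat => hy.
    have hx' : nth 0 s i <= x.
      have /(nthP 0)[j] := hx; rewrite size_takel // => hj <-.
      by rewrite nth_take // dsort_nth_le.
    apply: le_trans hx'; case/orP: hy => [|/hw //].
    move=> /(nthP 0)[j]; rewrite size_drop => hj <-; rewrite nth_drop.
    apply: dsort_nth_le; first by rewrite addSn ltnW // ltnS leq_addr.
    by rewrite -ltn_subRL -(size_sort >=%R u).
  rewrite perm_sort; apply: perm_trans (_ : perm_eq (s ++ w) _).
    by rewrite perm_cat2r perm_sym perm_sort.
  by rewrite -{1}(cat_take_drop i.+1 s) -catA perm_cat2l perm_sym perm_sort.
by rewrite E nth_cat size_takel // ltnSn nth_take.
Qed.

End SortNth.

(** * Partial sums of the largest beta numbers, through excesses over a threshold *)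

Section Dominance.
Variables (s : int * int) (v : rat * rat) (n : nat).
Implicit Types lam mu : bipart.

Local Notation beta := (beta s v).
Local Notation kappa := (kappa s v).
Local Notation "x ^+p" := (Num.max x 0) (at level 2, format "x ^+p").

Definition beads lam N : seq rat :=
  [seq beta lam c a | c <- [:: false; true], a <- iota 0 N].

Lemma beads_cat lam N : beads lam N =
  [seq beta lam false a | a <- iota 0 N] ++ [seq beta lam true a | a <- iota 0 N].
Proof. by rewrite /beads /= cats0. Qed.

Lemma size_beads lam N : size (beads lam N) = (N + N)%N.
Proof. by rewrite beads_cat size_cat !size_map !size_iota. Qed.

Lemma beta_decr lam c a b : is_bipart n lam -> (a <= b)%N ->
  beta lam c b <= beta lam c a.
Proof.
move=> hlam hab; rewrite /Defs.beta lerD2r; apply: lerB.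
  by rewrite ler_nat; apply: part_decr hab; exact: hlam.
by rewrite ler_nat.
Qed.

(** A row beyond [i] has a value below those of the rows 0, ..., i of its own component, hence below
    i + 1 values already listed. So one list of N rows serves for all indices below N. *)
Lemma kappa_beads lam N i : is_bipart n lam -> (i < N)%N ->
  kappa lam i = nth 0 (sort >=%R (beads lam N)) i.
Proof.
move=> hlam hi; rewrite /Defs.kappa -/(beads lam i.+1).
pose w := [seq beta lam false a | a <- iota i.+1 (N - i.+1)] ++
          [seq beta lam true a | a <- iota i.+1 (N - i.+1)].
have -> : sort >=%R (beads lam N) = sort >=%R (beads lam i.+1 ++ w).
  apply/(perm_sortP ge_total ge_trans ge_anti).
  rewrite !beads_cat /w -(subnKC hi) iotaD !map_cat add0n addKn.
  by rewrite -!catA perm_cat2l perm_catCA.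
rewrite dsort_nth_cat // ?size_beads; first by lia.
move=> x hx; apply: dsort_nth_ge.
have key c : (forall a, (a <= i)%N -> x <= beta lam c a) ->
    (i < count (>= x) [seq beta lam c a | a <- iota 0 i.+1])%N.
  move=> h; rewrite count_map (@eq_in_count _ _ xpredT) ?count_predT ?size_iota //.
  by move=> a; rewrite mem_iota => /= ha; rewrite h //; lia.
rewrite beads_cat count_cat.
move: hx; rewrite mem_cat => /orP[] /mapP[b]; rewrite mem_iota => /andP[hb _] e.
- by apply: ltn_addr; apply: key => a ha; rewrite e; apply: beta_decr => //; lia.
- by apply: ltn_addl; apply: key => a ha; rewrite e; apply: beta_decr => //; lia.
Qed.

(** Additive over the beads, hence computable without sorting them, unlike the partial sums of
    [kappa]. *)
Definition excess lam N x : rat := \sum_(y <- beads lam N) (y - x)^+p.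

Lemma sum_kappa_le lam N x T : is_bipart n lam -> (T <= N)%N ->
  \sum_(i < T) kappa lam i <= T%:R * x + excess lam N x.
Proof.
move=> hlam hT; rewrite /excess -(perm_big _ (permEl (perm_sort >=%R _))) /=.
rewrite (big_nth 0) size_sort size_beads big_mkord.
rewrite (eq_bigr (fun i : 'I_T => nth 0 (sort >=%R (beads lam N)) i)); last first.
  by move=> i _; apply: kappa_beads => //; apply: leq_trans hT.
have hTN : (T <= N + N)%N by lia.
rewrite (big_ord_widen _ (fun i => nth 0 (sort >=%R (beads lam N)) i) hTN).
have -> : T%:R * x = \sum_(i < N + N | (i < T)%N) x.
  by rewrite -(big_ord_widen _ (fun=> x) hTN) sumr_const card_ord mulr_natl.
rewrite [X in _ <= _ + X](bigID (fun i : 'I_(N + N) => (i < T)%N)) /= addrA -big_split /=.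
apply: ler_wpDr; first by apply: sumr_ge0 => i _; rewrite le_max lexx orbT.
by apply: ler_sum => i _; rewrite -lerBlDl le_max lexx.
Qed.

Lemma sum_kappa_eq lam N x T : is_bipart n lam -> (T <= N)%N ->
  (forall i, (i < T)%N -> x <= nth 0 (sort >=%R (beads lam N)) i) ->
  (forall i, (T <= i < N + N)%N -> nth 0 (sort >=%R (beads lam N)) i <= x) ->
  \sum_(i < T) kappa lam i = T%:R * x + excess lam N x.
Proof.
move=> hlam hT h1 h2; rewrite /excess -(perm_big _ (permEl (perm_sort >=%R _))) /=.
rewrite (big_nth 0) size_sort size_beads big_mkord.
rewrite (eq_bigr (fun i : 'I_T => nth 0 (sort >=%R (beads lam N)) i)); last first.
  by move=> i _; apply: kappa_beads => //; apply: leq_trans hT.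
have hTN : (T <= N + N)%N by lia.
rewrite (big_ord_widen _ (fun i => nth 0 (sort >=%R (beads lam N)) i) hTN).
have -> : T%:R * x = \sum_(i < N + N | (i < T)%N) x.
  by rewrite -(big_ord_widen _ (fun=> x) hTN) sumr_const card_ord mulr_natl.
rewrite [X in _ = _ + X](bigID (fun i : 'I_(N + N) => (i < T)%N)) /= addrA -big_split /=.
rewrite [X in _ = _ + X]big1 ?addr0; last first.
  by move=> i; rewrite -leqNgt => hi; apply/max_idPr; rewrite subr_le0 h2 // hi /=.
apply: eq_bigr => i hi; have := h1 i hi; rewrite -subr_ge0 => /max_idPl ->.
by rewrite addrC subrK.
Qed.

(** The change of the excess over [x] when a bead moves from [y] to y + 1, that is, when a node is
    added to its row. It is nondecreasing in [y] because the positive part is convex. *)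
Definition gain x y : rat := (y + 1 - x)^+p - (y - x)^+p.

Lemma gain_mono x y z : y <= z -> gain x y <= gain x z.
Proof.
rewrite /gain => h; case: (lerP (y + 1 - x) 0) => ?; case: (lerP (y - x) 0) => ?;
  case: (lerP (z + 1 - x) 0) => ?; case: (lerP (z - x) 0) => ?; lra.
Qed.

Lemma gain_lt y z : y < z -> gain z y < gain z z.
Proof.
rewrite /gain => h; case: (lerP (y + 1 - z) 0) => ?; case: (lerP (y - z) 0) => ?;
  case: (lerP (z + 1 - z) 0) => ?; case: (lerP (z - z) 0) => ?; lra.
Qed.

Lemma sum_gain x y (m : nat) : \sum_(b < m) gain x (y + b%:R) =
  (y + m%:R - x)^+p - (y - x)^+p.
Proof.
elim: m => [|m IH]; first by rewrite big_ord0 addr0 subrr.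
rewrite big_ord_recr /= IH /gain -natr1 -!addrA [1 + (- x)]addrC !addrA.
by rewrite [_ - x + 1]addrAC; ring.
Qed.

(** The position of the bead of row [a] just before the node (a, b) is added: the content, up to a
    shift depending on the component. *)
Definition height (a b : nat) (c : bool) : rat :=
  b%:R - a.+1%:R + ((comp s c)%:~R - comp v c).

(** Each row is built node by node from the empty bipartition, and [sum_gain] telescopes along it.
    The tableau serves only to enumerate the nodes. *)
Lemma excess_tableau lam N x (t : tableau n) : is_bipart n lam ->
  t \in std_tableaux n lam -> (n <= N)%N ->
  excess lam N x = excess ([::], [::]) N x +
    \sum_i gain x (height (trow t i) (tcol t i) (tcomp t i)).
Proof.
move=> hlam ht hN.
rewrite (@sum_tableau n rat t lam (fun a b c => gain x (height a b c))) //.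
have E mu : excess mu N x = \sum_(c : bool) \sum_(a < N) (beta mu c a - x)^+p.
  rewrite /excess beads_cat big_cat big_bool /= addrC !big_map.
  by congr (_ + _); rewrite -{1}(subn0 N) -[iota _ _]/(index_iota 0 N) big_mkord.
rewrite !E -big_split /=; apply: eq_bigr => c _.
rewrite (big_ord_widen _ (fun a => \sum_(b < part lam c a) gain x (height a b c)) hN).
rewrite [X in _ + X]big_mkcond -big_split /=; apply: eq_bigr => a _.
have B mu : beta mu c a = height a 0 c + (part mu c a)%:R.
  by rewrite /Defs.beta /height sub0r; ring.
have P0 : part ([::], [::]) c a = 0%N by rewrite /part; case: (c); rewrite nth_nil.
rewrite !B P0 addr0.
have -> : (if (a < n)%N then \sum_(b < part lam c a) gain x (height a b c) else 0) =
   \sum_(b < part lam c a) gain x (height a 0 c + b%:R).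
  case: ltnP => ha; last by rewrite (part_default c hlam ha) big_ord0.
  by apply: eq_bigr => b _; congr gain; rewrite /height sub0r; ring.
by rewrite sum_gain addrC subrK.
Qed.

(* The partial sum of the T largest values is the minimum over x of T x + excess x,
   so dominance follows from comparing the excesses. *)
Lemma dominated_of_excess lam mu : is_bipart n lam -> is_bipart n mu ->
  (forall N x, (n <= N)%N -> excess mu N x <= excess lam N x) ->
  forall T, (1 <= T)%N -> \sum_(i < T) kappa mu i <= \sum_(i < T) kappa lam i.
Proof.
move=> hlam hmu hE T hT; pose N := (T + n)%N.
have hTN : (T <= N)%N by rewrite leq_addr.
(* The T-th largest bead of [lam] is a threshold at which the bound of [sum_kappa_le] is
   attained. *)
pose x := nth 0 (sort >=%R (beads lam N)) T.-1.
rewrite [X in _ <= X](@sum_kappa_eq lam N x) //.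
- by apply: le_trans (sum_kappa_le x hmu hTN) _; rewrite lerD2l hE // leq_addl.
- by move=> i hi; apply: dsort_nth_le; rewrite ?size_beads; lia.
- by move=> i hi; apply: dsort_nth_le; rewrite ?size_beads; lia.
Qed.

(** Let T be the number of beads of [lam] above [x]. The sum of the first T values is exactly T x
    plus the excess for [lam], and at most T x plus the smaller excess for [mu]. *)
Lemma kappa_neq_of_excess lam mu x : is_bipart n lam -> is_bipart n mu ->
  (forall N, (n <= N)%N -> excess mu N x < excess lam N x) ->
  kappa mu <> kappa lam.
Proof.
move=> hlam hmu hE heq.
have [N0 hN0] : exists N0 : nat, forall c a, (N0 <= a)%N -> beta lam c a <= x.
  pose M : rat := n%:R + Num.max (height 0 0 false) (height 0 0 true) - x + 1.
  exists (Num.bound `|M|) => c a ha.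
  have hM : M < a%:R.
    apply: le_lt_trans (ler_norm _) _; apply: lt_le_trans (archi_boundP (normr_ge0 M)) _.
    by rewrite ler_nat.
  have hp : (part lam c a)%:R <= n%:R :> rat by rewrite ler_nat; apply: part_le_size hlam.
  have hm : height 0 0 c <= Num.max (height 0 0 false) (height 0 0 true).
    by case: (c); rewrite le_max lexx ?orbT.
  have -> : beta lam c a = (part lam c a)%:R - a%:R + height 0 0 c.
    by rewrite /Defs.beta /height -natr1; ring.
  rewrite /M in hM; lra.
(* In each component the beads above [x] lie in the first N0 rows. Doubling N0 + n ensures T <= N
   although both components contribute. *)
pose N := ((N0 + n) + (N0 + n))%N.
pose T := count (> x) (beads lam N).
have hTN : (T <= N)%N.
  rewrite /T beads_cat count_cat; apply: leq_add.
    rewrite count_map -{1}[N](subnKC (leq_addr (N0 + n) (N0 + n))) iotaD count_cat.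
    rewrite addnC (@eq_in_count _ _ xpred0) ?count_pred0 //.
      by rewrite add0n (leq_trans (count_size _ _)) // size_iota.
    by move=> a; rewrite mem_iota => ha /=; apply/negbTE; rewrite -leNgt hN0 //; lia.
  rewrite count_map -{1}[N](subnKC (leq_addr (N0 + n) (N0 + n))) iotaD count_cat.
  rewrite addnC (@eq_in_count _ _ xpred0) ?count_pred0 //.
    by rewrite add0n (leq_trans (count_size _ _)) // size_iota.
  by move=> a; rewrite mem_iota => ha /=; apply/negbTE; rewrite -leNgt hN0 //; lia.
have hS : \sum_(i < T) kappa lam i = T%:R * x + excess lam N x.
  apply: sum_kappa_eq => // i hi.
    apply: dsort_nth_ge; apply: leq_trans hi _; apply: sub_count => y /=; exact: ltW.
  rewrite leNgt; apply/negP => hlt.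
  case/andP: hi => hTi; rewrite -(size_beads lam) => hi.
  suff : (i < T)%N by lia.
  rewrite /T -(count_sort >=%R) -(cat_take_drop i.+1 (sort _ _)) count_cat.
  apply: ltn_addr; rewrite (eq_in_count (a2 := xpredT)).
    by rewrite count_predT size_takel // size_sort.
  move=> y /(nthP 0)[j]; rewrite size_takel ?size_sort // => hj <-.
  rewrite nth_take //= (lt_le_trans hlt) //; apply: dsort_nth_le => //; lia.
have := sum_kappa_le x hmu hTN; rewrite heq hS lerD2l leNgt hE //.
by rewrite /N; lia.
Qed.

Lemma ll_antisym lam mu : ll s v lam mu -> ll s v mu lam -> lam = mu.
Proof.
case=> [//|[hne h1]] [//|[_ h2]]; case: hne; apply: functional_extensionality_dep => i.
have S T : \sum_(i < T) kappa lam i = \sum_(i < T) kappa mu i.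
  case: T => [|T]; first by rewrite !big_ord0.
  by apply/eqP; rewrite eq_le h1 ?h2.
by have := S i.+1; rewrite !big_ord_recr /= S => /addrI.
Qed.

(* Here s.1 = s.2 and v.1 < v.2 enter: among nodes of equal content, those of the first
   component are the higher ones. *)
Lemma ll_of_content lam mu (t t' : tableau n) : s.1 = s.2 -> v.1 < v.2 ->
  is_bipart n lam -> is_bipart n mu ->
  t \in std_tableaux n lam -> t' \in std_tableaux n mu ->
  (forall i, tcomp t i = false) ->
  (forall i, tcol t' i + trow t i <= tcol t i + trow t' i)%N -> ll s v mu lam.
Proof.
move=> hs hv hlam hmu ht ht' hc hle.
pose h (u : tableau n) i := height (trow u i) (tcol u i) (tcomp u i).
have H i : h t' i <= h t i.
  rewrite /h /height hc; have := hle i.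
  rewrite -(@ler_nat rat) !natrD -!natr1.
  by case: (tcomp t' i) => /=; rewrite -?hs; lra.
have hE N x : (n <= N)%N -> excess mu N x <= excess lam N x.
  move=> hN; rewrite (excess_tableau x hlam ht hN) (excess_tableau x hmu ht' hN).
  by rewrite lerD2l; apply: ler_sum => i _; apply: gain_mono; apply: H.
have hdom := dominated_of_excess hlam hmu hE.
have [heq|] := pselect (forall i, h t' i = h t i); last first.
  (* At the threshold [h t i] the gain of the entry [i] is strictly larger for [t] than for [t']. *)
  move=> /existsNP[i /eqP hi]; right; split=> //.
  have {}hi : h t' i < h t i by rewrite lt_neqAle hi H.
  apply: (@kappa_neq_of_excess _ _ (h t i)) => // N hN.
  rewrite (excess_tableau _ hlam ht hN) (excess_tableau _ hmu ht' hN) ltrD2l.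
  rewrite (bigD1 i) //= [X in _ < X](bigD1 i) //=.
  by apply: ltr_leD; [apply: gain_lt | apply: ler_sum => j _; apply: gain_mono; apply: H].
left; suff tt : t = t' by apply: (std_shape_inj hmu hlam ht'); rewrite -tt.
(* In the second component a node of no larger content would have a height strictly smaller, by at
   least v.2 - v.1. *)
have hcc i : tcomp t' i = false.
  apply/negbTE/negP => hct; have := heq i; have := hle i.
  rewrite /h /height hc hct /= -hs -(@ler_nat rat) !natrD -!natr1; lra.
apply: (std_content_inj hlam hmu) => // i; first by rewrite hc hcc.
apply/eqP; rewrite -(eqr_nat rat) !natrD; have := heq i.
by rewrite /h /height hc hcc -!natr1 /= => hh; apply/eqP; lra.
Qed.

End Dominance.

(** * Composition multiplicities *)

Section Multiplicity.
Variables (F : fieldType) (n : nat) (q : F) (Q : F * F).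
Implicit Types V M : heckeModule n q Q.

Definition is_character M (c : 'I_n -> F) : Prop :=
  hrank M = 1%N /\ forall i, M i = (c i)%:M.

(* halg T c A a: the matrix A is a polynomial in the T i, and a is the value of this
   polynomial at T i = c i. *)
Inductive halg (R : comNzRingType) d (T : 'I_n -> 'M[R]_d) (c : 'I_n -> R) :
    'M[R]_d -> R -> Prop :=
| halg_gen i : halg T c (T i) (c i)
| halg_scalar a : halg T c a%:M a
| halg_add A B a b : halg T c A a -> halg T c B b -> halg T c (A + B) (a + b)
| halg_mul A B a b : halg T c A a -> halg T c B b -> halg T c (A *m B) (a * b).

Lemma halg_stable V c (U A : 'M_(hrank V)) a : hstable U -> halg V c A a -> stablemx U A.
Proof.
move=> hU; elim=> [i|b|B C b b' _ hB _ hC|B C b b' _ hB _ hC]; first exact: hU.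
- by rewrite mul_mx_scalar scalemx_sub.
- by rewrite mulmxDr addmx_sub.
- by rewrite mulmxA (submx_trans (submxMr _ hB)).
Qed.

Lemma halg_factor V c (W A : 'M_(hrank V)) a k (X : 'M_(hrank V, k)) : hstable W ->
  (forall i, W *m V i *m X = c i *: (W *m X)) -> halg V c A a ->
  W *m A *m X = a *: (W *m X).
Proof.
move=> hW hX hA; elim: hA => [i|b|B C b b' _ IHB _ IHC|B C b b' hB IHB hC IHC].
- exact: hX.
- by rewrite mul_mx_scalar -scalemxAl.
- by rewrite mulmxDr mulmxDl IHB IHC scalerDl.
- have /submxP[D hD] := halg_stable hW hB.
  rewrite mulmxA hD -mulmxA -(mulmxA D) (mulmxA W) IHC -scalemxAr mulmxA -hD IHB scalerA.
  by rewrite mulrC.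
Qed.

Lemma halg_big (R : comNzRingType) d (T : 'I_n -> 'M[R]_d) c (I : Type) (r : seq I)
    (P : pred I) (A : I -> 'M[R]_d) a : (forall i, P i -> halg T c (A i) (a i)) ->
  halg T c (\big[mulmx/1%:M]_(i <- r | P i) A i) (\prod_(i <- r | P i) a i).
Proof.
move=> h; elim: r => [|i r IH]; first by rewrite !big_nil; apply: halg_scalar.
by rewrite !big_cons; case: ifP => // Pi; apply: halg_mul => //; apply: h.
Qed.

(** A submodule of least rank among those strictly above [U] covers [U]; the induction is on the
    codimension. *)
Lemma series_exists V (U : 'M_(hrank V)) : hstable U ->
  exists s : seq 'M_(hrank V),
    (forall UW, UW \in zip (U :: s) s -> hcover UW.1 UW.2) /\ row_full (last U s).
Proof.
have [m] := ubnP (hrank V - \rank U)%N; elim: m U => // m IH U; rewrite ltnS => hm hU.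
have [hf|hnf] := boolP (row_full U); first by exists [::].
pose P k := `[< exists W : 'M_(hrank V), [/\ hstable W, (U < W)%MS & \rank W = k] >].
have exP : exists k, P k.
  exists (\rank (1%:M : 'M[F]_(hrank V))); apply/asboolP; exists 1%:M; split=> //.
    by move=> i; rewrite submx1.
  by rewrite /ltmx submx1 sub1mx.
have [k /asboolP[W [hW hUW hk]] hmin] := ex_minnP exP.
have hcov : hcover U W.
  split=> // X hX /andP[hUX hXW].
  have [hXU|hXU] := boolP (X <= U)%MS; [by left | right].
  have hr : (k <= \rank X)%N by apply: hmin; apply/asboolP; exists X; rewrite /ltmx hUX.
  by rewrite -(geq_leqif (mxrank_leqif_sup hXW)) hk.
have hlt : (\rank U < \rank W)%N by apply: rank_ltmx.
have hWd := rank_leq_row W.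
have [||s [hs hl]] := IH W => //; first by lia.
exists (W :: s); split=> // UW; rewrite inE => /orP[/eqP -> //|]; exact: hs.
Qed.

Lemma composition_seriesP V : composition_series
  (xget [::] [set s | @composition_series F n q Q V s]%classic).
Proof.
have [s hs] : exists s, @composition_series F n q Q V s.
  have h0 : hstable (0 : 'M_(hrank V)) by move=> i; rewrite mul0mx sub0mx.
  by have [s hs] := series_exists h0; exists s.
by apply: (xgetPex [::] (P := [set s | @composition_series F n q Q V s]%classic)); exists s.
Qed.

Lemma comp_mult_neq0 V M : comp_mult V M <> 0%N ->
  exists U W : 'M_(hrank V), hcover U W /\ factor_iso M U W.
Proof.
rewrite /comp_mult; move: (composition_seriesP V).
set s := xget _ _ => -[hs _] /eqP; rewrite -lt0n -has_count.
by case/hasP=> -[U W] /hs /= h1 /asboolP h2; exists U, W.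
Qed.

(** A nonzero vector enters a composition series at exactly one step, so the number of steps that it
    enters telescopes to 1. *)
Lemma comp_mult_eq1 V M (w : 'rV_(hrank V)) : w != 0 ->
  (forall U W : 'M_(hrank V), hcover U W ->
     (factor_iso M U W <-> (w <= W)%MS /\ ~~ (w <= U)%MS)) ->
  comp_mult V M = 1%N.
Proof.
move=> w0 hw; rewrite /comp_mult; move: (composition_seriesP V).
set s := xget _ _; case=> hs hl.
suff H (r : seq 'M_(hrank V)) U : (forall UW, UW \in zip (U :: r) r -> hcover UW.1 UW.2) ->
    ((w <= U)%MS -> (w <= last U r)%MS) /\
    count (fun UW => `[< factor_iso M UW.1 UW.2 >]) (zip (U :: r) r) =
    ((w <= last U r)%MS && ~~ (w <= U)%MS).
  have [_ ->] := H s 0 hs; rewrite submx0 w0 andbT.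
  by rewrite (submx_trans (submx1 w)) // sub1mx.
elim: r U {hs hl} => [|W r IH] U hs /=; first by split=> //; rewrite andbN.
have [|h1 h2] := IH W; first by move=> UW h; apply: hs; rewrite /= inE h orbT.
have hc : hcover U W by apply: (hs (U, W)); rewrite /= inE eqxx.
have hUW : (w <= U)%MS -> (w <= W)%MS.
  by case: hc => _ _ /andP[h _] _ /submx_trans; apply.
split; first by move/hUW/h1.
rewrite h2; have -> : `[< factor_iso M U W >] = (w <= W)%MS && ~~ (w <= U)%MS.
  by apply/asboolP/andP; apply (hw U W hc).
case: (w <= W)%MS h1 hUW => [/(_ isT) -> _|_ hUW] /=; first by rewrite addn0.
by case: (w <= U)%MS hUW => [/(_ isT)|_] //=; rewrite andbT.
Qed.

Lemma factor_iso_character V M c (U W : 'M_(hrank V)) : is_character M c ->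
  factor_iso M U W -> exists X : 'cV_(hrank V),
    [/\ forall i, W *m V i *m X = c i *: (W *m X), row_full (W *m X) &
        (W :&: kermx X == U)%MS].
Proof.
case: M => d T hT [/= ed hc] [X /= [h1 h2 h3]]; subst d; exists X; split=> // i.
by rewrite h1 hc mul_mx_scalar.
Qed.

Lemma factor_iso_eigenvalue V M c (U W A : 'M_(hrank V)) a : is_character M c ->
  hstable W -> factor_iso M U W -> halg V c A a -> A = 0 -> a = 0.
Proof.
move=> hM hW /(factor_iso_character hM)[X [hX hfull _]] hA A0.
have := halg_factor hW hX hA; rewrite A0 mulmx0 mul0mx => /esym/eqP.
rewrite scaler_eq0 => /orP[/eqP //|/eqP E].
by move: hfull; rewrite E /row_full mxrank0.
Qed.

(** [E] acts as the identity on the factor, so [W *m E] is not contained in [U]; being nonzero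
    inside the line of [w], it spans that line. *)
Lemma factor_iso_vector V M c (U W E : 'M_(hrank V)) (w : 'rV_(hrank V)) :
  is_character M c -> hcover U W -> factor_iso M U W -> halg V c E 1 ->
  (E <= w)%MS -> (w <= W)%MS /\ ~~ (w <= U)%MS.
Proof.
move=> hM [hU hW hUW _] /(factor_iso_character hM)[X [hX hfull hker]] hE hEw.
have hWEX := halg_factor hW hX hE; rewrite scale1r in hWEX.
have /submxP[y hy] : (W *m E <= w)%MS by apply: submx_trans hEw; apply: submxMl.
have hWX0 : W *m X != 0.
  by apply/eqP => E0; move: hfull; rewrite E0 /row_full mxrank0.
have y0 : y != 0.
  by apply: contraNneq hWX0 => y0; rewrite -hWEX hy y0 !mul0mx.
split.
  have hWE := halg_stable hW hE.
  have /row_fullP[z hz] : row_full y.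
    by rewrite /row_full; move: y0; rewrite -mxrank_eq0; have := rank_leq_col y; lia.
  have -> : w = z *m (W *m E) by rewrite hy mulmxA hz mul1mx.
  by apply: submx_trans hWE; apply: submxMl.
apply/negP => hwU; move: hWX0; rewrite -hWEX hy -mulmxA.
have : (w <= kermx X)%MS.
  by apply: submx_trans (capmxSr W _); rewrite (eqmxP hker).
by move/sub_kermxP => ->; rewrite mulmx0 eqxx.
Qed.

(** Modulo [U] the line of [w] is stable, so W = U + w because [W] covers [U]. The isomorphism is a
    linear form that kills [U] and takes the value 1 at [w]. *)
Lemma vector_factor_iso V M c (U W : 'M_(hrank V)) (w : 'rV_(hrank V)) :
  is_character M c -> hcover U W -> (w <= W)%MS -> ~~ (w <= U)%MS ->
  (forall i, (w *m V i - c i *: w <= U)%MS) -> factor_iso M U W.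
Proof.
move=> hM [hU hW hUW hmax] hwW hwU hw.
have hWe : (W <= U + w)%MS.
  have hst : hstable (U + w)%MS.
    move=> i; rewrite addsmxMr addsmx_sub; apply/andP; split.
      exact: submx_trans (hU i) (addsmxSl _ _).
    rewrite -[w *m V i](subrK (c i *: w)); apply: addmx_sub.
      exact: submx_trans (hw i) (addsmxSl _ _).
    by apply: scalemx_sub; apply: addsmxSr.
  case: (hmax _ hst) => //.
    by rewrite addsmxSl addsmx_sub hwW andbT; case/andP: hUW.
  by move=> h; case/negP: hwU; apply: submx_trans h; apply: addsmxSr.
have [B hB] : exists B : 'cV_(hrank V), w *m cokermx U *m B = 1%:M.
  apply/row_freeP; rewrite /row_free; move: hwU; rewrite submxE -mxrank_eq0.
  by have := rank_leq_row (w *m cokermx U); lia.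
pose X := cokermx U *m B.
have hUX k (Y : 'M_(k, hrank V)) : (Y <= U)%MS -> Y *m X = 0.
  by rewrite submxE => /eqP h; rewrite /X mulmxA h mul0mx.
have hwX : w *m X = 1%:M by rewrite mulmxA.
have key : [/\ forall i, W *m V i *m X = c i *: (W *m X), row_full (W *m X) &
    (W :&: kermx X == U)%MS].
  split.
  - have /sub_addsmxP[[A y] /= ->] := hWe; move=> i.
    have h1 : A *m U *m V i *m X = 0.
      by apply: hUX; rewrite -mulmxA; apply: submx_trans (submxMl _ _) (hU i).
    have h2 : w *m V i *m X = c i *: (w *m X).
      by rewrite -(subrK (c i *: w) (w *m V i)) mulmxDl hUX // add0r -scalemxAl.
    rewrite !mulmxDl h1 (hUX _ (A *m U)) ?submxMl // !add0r.
    by rewrite -(mulmxA y w (V i)) -(mulmxA y (w *m V i)) h2 -scalemxAr mulmxA.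
  - by case/submxP: hwW => z hz; apply/row_fullP; exists z; rewrite mulmxA -hz.
  - apply/andP; split; last first.
      rewrite sub_capmx; case/andP: hUW => -> _ /=; apply/sub_kermxP; exact: hUX.
    have h : (W :&: kermx X <= U + w)%MS by apply: submx_trans hWe; apply: capmxSl.
    have /sub_addsmxP[[A y] /= e] := h.
    have /sub_kermxP := capmxSr W (kermx X).
    rewrite e mulmxDl (hUX _ (A *m U)) ?submxMl // add0r -mulmxA hwX mulmx1 => ->.
    by rewrite mul0mx addr0 submxMl.
case: M hM => d T hT [/= ed hc]; subst d.
by exists X => /=; case: key => h1 h2 h3; split=> // i; rewrite h1 hc mul_mx_scalar.
Qed.

End Multiplicity.

(** * Sign vectors in simple modules *)

Section TypeAModule.
Variables (F : fieldType) (d n : nat) (q c0 : F) (T : nat -> 'M[F]_d).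
Hypotheses (q_neq0 : q != 0) (q_neq1 : q != 1) (c0_neq0 : c0 != 0).
Hypothesis T0 : T 0 = c0%:M.
Hypothesis Tquad : forall i, (0 < i < n)%N -> T i *m T i = (q - 1) *: T i + q%:M.
Hypothesis Tbraid : forall i, (0 < i)%N -> (i.+1 < n)%N ->
  T i *m T i.+1 *m T i = T i.+1 *m T i *m T i.+1.
Hypothesis Tcomm : forall i j, (i.+2 <= j < n)%N -> T i *m T j = T j *m T i.

(** [JM k] is L_(k+1), defined by the recursion L_(k+1) = q^-1 T_k L_k T_k so that commutation can
    be proved by induction. *)
Fixpoint JM (k : nat) : 'M[F]_d :=
  if k is k'.+1 then q^-1 *: (T k *m JM k' *m T k) else T 0.

Lemma JM_comm_above k s : (k.+2 <= s < n)%N -> JM k *m T s = T s *m JM k.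
Proof.
elim: k => [|k IH] hs; first exact: Tcomm.
rewrite /= -/(JM _) -scalemxAl -scalemxAr; congr (_ *: _).
rewrite -!mulmxA Tcomm // (mulmxA (JM k)) IH; last by lia.
by rewrite !mulmxA Tcomm.
Qed.

(** The critical case is s = k - 1. After unfolding the recursion twice, one braid relation on the
    right turns T s into T k, which commutes with the inner [JM (k - 2)], and a second one on the
    left turns it back. *)
Lemma JM_comm_below k s : (0 < s < k)%N -> (k < n)%N -> JM k *m T s = T s *m JM k.
Proof.
elim: k s => [|k IH] s hs hk; first by lia.
have [hsk|hsk] := ltnP s k.
  rewrite /= -scalemxAl -scalemxAr; congr (_ *: _).
  have h : T s *m T k.+1 = T k.+1 *m T s by apply: Tcomm; lia.
  rewrite -(mulmxA _ (T k.+1) (T s)) -h !mulmxA h -!mulmxA.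
  by congr (_ *m _); rewrite !mulmxA IH //; lia.
have {hsk hs} [k' ek es] : exists2 k', k = k'.+1 & s = k by exists k.-1; lia.
subst s k; rewrite /= -/(JM _); do 3 rewrite -?scalemxAl -?scalemxAr.
congr (_ *: (_ *: _)).
have hb := @Tbraid k'.+1 isT hk.
rewrite -!mulmxA (mulmxA (T k'.+1) (T k'.+2)) hb.
rewrite -!mulmxA (mulmxA (JM k')) JM_comm_above; last by lia.
by rewrite !mulmxA hb.
Qed.

Lemma T_JM k : (0 < k < n)%N ->
  T k *m JM k = (q - 1) *: JM k + JM k.-1 *m T k.
Proof.
case: k => // k hk; rewrite [JM k.+1]/= -/(JM k) -scalemxAr !mulmxA Tquad //.
rewrite !mulmxDl -!scalemxAl mul_scalar_mx -scalemxAl scalerDr !scalerA.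
by rewrite mulVf // scale1r [q^-1 * _]mulrC.
Qed.

(** The value of [JM k] on the sign character for which T 0 is c0. *)
Definition content_val (k : nat) : F := c0 / q ^+ k.
Local Notation j := content_val.

Lemma content_valS k : j k = q * j k.+1.
Proof. by rewrite /content_val exprS invfM mulrCA mulVKf // mulrCA. Qed.

Lemma content_val_neq k : j k != j k.+1.
Proof.
rewrite content_valS -subr_eq0 -[X in _ - X]mul1r -mulrBl mulf_neq0 ?subr_eq0 //.
by rewrite mulf_neq0 // invr_eq0 expf_neq0.
Qed.

Fixpoint down (k i : nat) : 'M[F]_d :=
  if i is i'.+1 then down k i' *m T (k - i') else 1%:M.

Lemma downS k i : (i <= k)%N -> down k.+1 i.+1 = T k.+1 *m down k i.
Proof.
elim: i => [|i IH] hi; first by rewrite /= mul1mx subn0 mulmx1.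
by rewrite [LHS]/= -/(down k.+1 i.+1) IH ?(ltnW hi) // subSS mulmxA.
Qed.

Lemma down_comm_low k i s : (0 < s)%N -> (s + i < k)%N -> (k < n)%N ->
  down k i *m T s = T s *m down k i.
Proof.
move=> s0; elim: i => [|i IH] hs hk; first by rewrite mul1mx mulmx1.
by rewrite /= -mulmxA -Tcomm ?mulmxA ?IH //; lia.
Qed.

Lemma down_comm_high k i s : (k < n)%N -> (i <= k)%N -> (k.+1 < s + i)%N ->
  (s <= k)%N -> down k i *m T s = T s.-1 *m down k i.
Proof.
move=> hk; elim: i => [|i IH] hi hs hsk; first by lia.
have [h|h] := ltnP k.+1 (s + i).
  by rewrite /= -mulmxA Tcomm ?mulmxA ?IH //; lia.
have {h hs} es : s = (k - i).+1 by lia.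
case: i IH hi es => [|i] IH hi es; first by lia.
have ea : (k - i)%N = (k - i.+1).+1 by lia.
have a0 : (0 < k - i.+1)%N by lia.
have an : ((k - i.+1).+1 < n)%N by lia.
rewrite /= es /= ea; move: (Tbraid a0 an) => hb.
rewrite -!mulmxA (mulmxA (T (k - i.+1).+1)) -hb !mulmxA.
by rewrite down_comm_low //; lia.
Qed.

Lemma JM_comm_down k i : (i <= k)%N -> (k.+1 < n)%N ->
  down k i *m JM k.+1 = JM k.+1 *m down k i.
Proof.
elim: i => [|i IH] hi hk; first by rewrite mul1mx mulmx1.
have h : JM k.+1 *m T (k - i) = T (k - i) *m JM k.+1 by apply: JM_comm_below; lia.
by rewrite [down k i.+1]/= -mulmxA -h mulmxA IH ?mulmxA //; lia.
Qed.

(** * Restriction to, and induction from, the algebra of the first generators *)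

Definition Tstable k (X : 'M[F]_d) := forall s, (s < k)%N -> (X *m T s <= X)%MS.

Definition Tsimple k (X : 'M[F]_d) :=
  X != 0 /\ forall Y : 'M_d, Tstable k Y -> (Y <= X)%MS -> Y = 0 \/ (X <= Y)%MS.

Lemma Tstable_sub m k (X : 'M_d) (Y : 'M_(m, d)) s : Tstable k X -> (s < k)%N ->
  (Y <= X)%MS -> (Y *m T s <= X)%MS.
Proof. by move=> hX hs hY; apply: submx_trans (hX s hs); apply: submxMr. Qed.

Lemma Tstable_down m k (X : 'M_d) (Y : 'M_(m, d)) i : Tstable k.+1 X ->
  (Y <= X)%MS -> (Y *m down k i <= X)%MS.
Proof.
move=> hX hY; elim: i => [|i IH]; first by rewrite mulmx1.
by rewrite /= mulmxA; apply: Tstable_sub hX _ IH; lia.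
Qed.

Lemma Tstable_JM k (X : 'M_d) : Tstable k.+1 X -> (X *m JM k <= X)%MS.
Proof.
suff H i (Y : 'M_d) : (i <= k)%N -> Tstable k.+1 X -> (Y <= X)%MS ->
    (Y *m JM i <= X)%MS by move=> hX; apply: H.
elim: i Y => [|i IH] Y hi hX hY; first by apply: Tstable_sub hX _ hY.
rewrite /= -scalemxAr !mulmxA; apply: scalemx_sub.
apply: (Tstable_sub hX); first by lia.
by apply: IH => //; [lia | apply: (Tstable_sub hX)].
Qed.

(* The module induced from E by one more generator T k, type A double cosets giving the
   representatives down k i = T k T (k-1) ... *)
Definition ext k (E : 'M[F]_d) : 'M_d := (\sum_(i < k.+1) E *m down k i)%MS.

Lemma sub_ext k (E : 'M_d) : (E <= ext k E)%MS.
Proof. by apply: (sumsmx_sup ord0) => //; rewrite mulmx1. Qed.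

Lemma down_sub_ext k (E : 'M_d) i : (i <= k)%N -> (E *m down k i <= ext k E)%MS.
Proof. by move=> hi; apply: (sumsmx_sup (Ordinal (hi : (i < k.+1)%N))). Qed.

Lemma ext_sub k (E X : 'M_d) : Tstable k.+1 X -> (E <= X)%MS -> (ext k E <= X)%MS.
Proof. by move=> hX hE; apply/sumsmx_subP => i _; apply: Tstable_down. Qed.

Lemma Tstable0 (X : 'M_d) : (X *m T 0 <= X)%MS.
Proof. by rewrite T0 mul_mx_scalar scalemx_sub. Qed.

(** On the i-th translate, T s commutes past when s + i < k, lengthens the product when s + i = k,
    is absorbed by the quadratic relation when s + i = k + 1, and beyond that becomes T (s - 1)
    acting on [E], by a braid relation. *)
Lemma ext_stable k (E : 'M_d) : (k < n)%N -> Tstable k E -> Tstable k.+1 (ext k E).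
Proof.
move=> hk hE [|s] hs; first exact: Tstable0.
rewrite /ext sumsmxMr; apply/sumsmx_subP => -[i hi] _ /=.
have [h|h|h] := ltngtP (s.+1 + i) k.
- rewrite -mulmxA down_comm_low // mulmxA.
  by apply: submx_trans (down_sub_ext E (_ : i <= k)%N) => //; apply: submxMr; apply: hE; lia.
- have [h'|h'] := ltnP k.+1 (s.+1 + i); last first.
    have {h h'} [i' ei es] : exists2 i', i = i'.+1 & (k - i' = s.+1)%N.
      by exists i.-1; lia.
    rewrite ei /= es -!mulmxA Tquad; last by lia.
    rewrite mulmxDr mulmxDr -!scalemxAr mul_mx_scalar -!scalemxAr addmx_sub //.
      by apply: scalemx_sub; rewrite -es; apply: (down_sub_ext E (i := i'.+1)); lia.
    by apply: scalemx_sub; apply: down_sub_ext; lia.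
  rewrite -mulmxA down_comm_high //= mulmxA.
  by apply: submx_trans (down_sub_ext E (_ : i <= k)%N) => //; apply: submxMr; apply: hE; lia.
- have -> : E *m down k i *m T s.+1 = E *m down k i.+1.
    by rewrite /= mulmxA; congr (_ *m T _); lia.
  by apply: down_sub_ext; lia.
Qed.

Definition factors (M : 'M[F]_d) (rs : seq F) : 'M_d :=
  \big[mulmx/1%:M]_(r <- rs) (M - r%:M).

Lemma factors_cons M r rs : factors M (r :: rs) = (M - r%:M) *m factors M rs.
Proof. by rewrite /factors big_cons. Qed.

Lemma factors_eigen m (X : 'M[F]_(m, d)) (M : 'M[F]_d) (a : F) rs : X *m M = a *: X ->
  X *m factors M rs = (\prod_(r <- rs) (a - r)) *: X.
Proof.
move=> hX; elim: rs => [|r rs IH]; first by rewrite /factors !big_nil mulmx1 scale1r.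
rewrite factors_cons mulmxA mulmxBr hX mul_mx_scalar -scalerBl -scalemxAl IH.
by rewrite scalerA big_cons.
Qed.

Lemma eigen_capmxP m (Y : 'M[F]_(m, d)) (X M : 'M[F]_d) (a : F) :
  (Y <= X :&: kermx (M - a%:M))%MS = (Y <= X)%MS && (Y *m M == a *: Y).
Proof.
rewrite sub_capmx; congr (_ && _); rewrite (sameP sub_kermxP eqP) mulmxBr.
by rewrite mul_mx_scalar subr_eq0.
Qed.

(* L m acts on the translates of E by T m ... as L (m - 1) does on E, modulo E. *)
Lemma factors_down m (E : 'M_d) k (G : 'M_(k, d)) i rs : (0 < m < n)%N -> (i < m)%N ->
  Tstable m E -> E *m JM m = j m *: E -> (G <= E)%MS ->
  (G *m down m i.+1 *m factors (JM m) rs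
   - G *m factors (JM m.-1) rs *m down m i.+1 <= E)%MS.
Proof.
move=> hm him hE hEm.
have eig (H : 'M_(k, d)) : (H <= E)%MS -> H *m JM m = j m *: H.
  by case/submxP=> D ->; rewrite -mulmxA hEm -scalemxAr.
elim: rs G => [|r rs IH] G hG; first by rewrite /factors !big_nil !mulmx1 subrr sub0mx.
case: m hm him hE hEm eig IH => // m hm him hE hEm eig IH.
pose B := down m i; have eB : down m.+1 i.+1 = T m.+1 *m B by apply: downS; lia.
have e1 : G *m down m.+1 i.+1 *m (JM m.+1 - r%:M) =
   ((q - 1) * j m.+1) *: (G *m B) + G *m (JM m - r%:M) *m down m.+1 i.+1.
  have hT : T m.+1 *m JM m.+1 = (q - 1) *: JM m.+1 + JM m *m T m.+1 := T_JM hm.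
  have hB : B *m JM m.+1 = JM m.+1 *m B by apply: JM_comm_down; lia.
  have hG' := eig G hG; rewrite eB; move: (JM m.+1) (JM m) hT hB hG' => L L' hT hB hG'.
  rewrite mulmxBr -!mulmxA hB (mulmxA (T _)) hT mulmxDl mulmxDr -!scalemxAl -scalemxAr.
  rewrite (mulmxA G L) hG' -scalemxAl scalerA -addrA; congr (_ + _).
  by rewrite !mulmxA mulmxBr !mulmxBl !mul_mx_scalar -!scalemxAl.
have hGB : (G *m B <= E)%MS by apply: Tstable_down.
rewrite !factors_cons (mulmxA (G *m _)) e1 mulmxDl -addrA (mulmxA G (_ - _)).
apply: addmx_sub.
  rewrite -scalemxAl; apply: scalemx_sub.
  by rewrite (factors_eigen _ (eig _ hGB)); apply: scalemx_sub.
apply: IH; rewrite mulmxBr; apply: addmx_sub.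
  by apply: submx_trans (Tstable_JM hE); apply: submxMr.
by rewrite eqmx_opp mul_mx_scalar scalemx_sub.
Qed.

(** Where the later Jucys-Murphy elements have the weight of the sign, [JM m.-1] is annihilated by a
    polynomial that does not vanish at [j m]. *)
Hypothesis separation : forall m, (0 < m < n)%N -> exists2 rs : seq F,
  j m \notin rs &
  forall X : 'M_d, (forall i, (m <= i < n)%N -> X *m JM i = j i *: X) ->
    (X *m JM m.-1 <= X)%MS -> X *m factors (JM m.-1) rs = 0.

(** For a nonzero submodule E' of E, [ext m E'] contains [X] by simplicity. The polynomial of
    [separation] in [JM m.-1] kills E', so by [factors_down] the same polynomial in [JM m] maps
    [ext m E'] into E'. On E it is a nonzero scalar, hence E is contained in E'. *)
Lemma eigenspace_simple m (X : 'M_d) : (0 < m < n)%N -> Tstable m.+1 X ->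
  Tsimple m.+1 X -> (forall i, (m < i < n)%N -> X *m JM i = j i *: X) ->
  (X :&: kermx (JM m - (j m)%:M))%MS != 0 ->
  Tsimple m (X :&: kermx (JM m - (j m)%:M))%MS.
Proof.
move=> hm hX [X0 hsimple] heig; set E := (_ :&: _)%MS => E0; split=> // E' hE' hE'E.
have [->|E'0] := eqVneq E' 0; [by left | right].
have := hE'E; rewrite eigen_capmxP => /andP[hE'X /eqP hE'm].
have [rs hrs hsep] := separation hm.
have h0 : E' *m factors (JM m.-1) rs = 0.
  apply: hsep => [i hi|].
    have [->|hne] := eqVneq i m; first exact: hE'm.
    by case/submxP: hE'X => D ->; rewrite -mulmxA heig ?scalemxAr //; lia.
  by apply: Tstable_JM; rewrite prednK //; lia.
have hext : Tstable m.+1 (ext m E') by apply: ext_stable => //; lia.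
have hXext : (X <= ext m E')%MS.
  case: (hsimple _ hext (ext_sub hX hE'X)) => // ext0.
  by case/eqP: E'0; apply/eqP; rewrite -submx0 -ext0 sub_ext.
have hfac : (ext m E' *m factors (JM m) rs <= E')%MS.
  rewrite /ext sumsmxMr; apply/sumsmx_subP => -[[|i] hi] _ /=.
    by rewrite mulmx1 (factors_eigen _ hE'm) scalemx_sub.
  have := @factors_down m E' d E' i rs hm hi hE' hE'm (submx_refl _).
  by rewrite h0 mul0mx subr0.
have hEE : (E *m factors (JM m) rs <= E')%MS.
  apply: submx_trans hfac; apply: submxMr; apply: submx_trans hXext; exact: capmxSl.
have hEm : E *m JM m = j m *: E.
  by have := submx_refl E; rewrite {2}/E eigen_capmxP => /andP[_ /eqP].
rewrite (factors_eigen _ hEm) in hEE.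
rewrite -(eqmx_scale E (_ : \prod_(r <- rs) (j m - r) != 0)) //.
by rewrite prodf_seq_neq0; apply/allP => r hr; rewrite subr_eq0; apply: contraNneq hrs => ->.
Qed.

Lemma JM_comm_T_eigen m (X : 'M_d) s : (s < m < n)%N -> Tstable m.+1 X ->
  ((X :&: kermx (JM m - (j m)%:M)) *m T s <= X :&: kermx (JM m - (j m)%:M))%MS.
Proof.
set E := (_ :&: _)%MS => hs hX; rewrite eigen_capmxP.
have := submx_refl E; rewrite {2}/E eigen_capmxP => /andP[h1 /eqP h2].
apply/andP; split; first by apply: (Tstable_sub hX) => //; lia.
case: s hs => [|s] hs; first by rewrite T0 mul_mx_scalar -scalemxAl h2 scalerA mulrC -scalerA.
rewrite -mulmxA -JM_comm_below; [|lia..].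
by rewrite mulmxA h2 scalemxAl.
Qed.

(* A simple module containing a vector w whose weight is that of the sign character is the
   sign character: cut down to the successive eigenspaces of the Jucys-Murphy elements. *)
Lemma simple_sign m (X : 'M_d) (w : 'rV_d) : (0 < m <= n)%N -> Tstable m X ->
  Tsimple m X -> (forall i, (m <= i < n)%N -> X *m JM i = j i *: X) ->
  (w <= X)%MS -> w != 0 -> (forall i, (i < n)%N -> w *m JM i = j i *: w) ->
  forall s, (0 < s < m)%N -> w *m T s = - w.
Proof.
elim: m X => // -[_ X _ _ _ _ _ _ _ s|m IH X hm hX hsX heig hwX w0 hw]; first by lia.
set a := m.+1 in IH hm hX hsX heig *.
have ha : (0 < a < n)%N by lia.
pose E := (X :&: kermx (JM a - (j a)%:M))%MS.
have hwE : (w <= E)%MS by rewrite eigen_capmxP hwX hw ?eqxx //; lia.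
have E0 : E != 0 by apply: contraNneq w0 => E0; rewrite -submx0 -E0.
have hsE : Tsimple a E by apply: eigenspace_simple => // i hi; apply: heig; lia.
have hE : Tstable a E by move=> s hs; apply: JM_comm_T_eigen => //; lia.
have hwT : forall s, (0 < s < a)%N -> w *m T s = - w.
  apply: (IH E) => // [|i hi]; first by lia.
  have [->|hne] := eqVneq i a.
    by have := submx_refl E; rewrite {2}/E eigen_capmxP => /andP[_ /eqP].
  case/submxP: (capmxSl X (kermx (JM a - (j a)%:M))) => D; rewrite -/E => ->.
  by rewrite -mulmxA heig ?scalemxAr //; lia.
(* The defect in w T_a = - w. The lower generators preserve its line, and T_a multiplies it by q, so
   it is enough to exclude a nonzero [phi]. *)
pose phi := w *m T a + w.
have phiT s : (0 < s < m)%N -> phi *m T s = - phi.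
  move=> hs; rewrite mulmxDl -mulmxA -Tcomm; last by lia.
  by rewrite mulmxA hwT ?mulNmx ?opprD //; lia.
have phiTa : phi *m T a = q *: phi.
  rewrite mulmxDl -mulmxA Tquad // mulmxDr mul_mx_scalar -scalemxAr scalerBl scale1r.
  by rewrite addrAC subrK scalerDr.
have phi_st : Tstable m <<phi>>%MS.
  move=> [|s] hs; first exact: Tstable0.
  by rewrite (eqmxMr _ (genmxE _)) genmxE phiT // eqmx_opp.
(* The submodule generated by [phi]. There [JM a] acts by [j m], which differs from its value [j a]
   at [w]; so [U] cannot contain [w], and simplicity of [X] gives U = 0. *)
pose U := ext m <<phi>>%MS.
have hmn : (m < n)%N by lia.
have U_st : Tstable a.+1 U.
  move=> s hs; have [hsa|hsa] := ltnP s a; first by apply: ext_stable.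
  have -> : s = a by lia.
  rewrite /U /ext sumsmxMr; apply/sumsmx_subP => -[i hi] _ /=.
  rewrite -mulmxA (eqmxMr _ (genmxE _)).
  case: i hi => [|i] hi.
    by rewrite mul1mx phiTa scalemx_sub // -genmxE; apply: sub_ext.
  have em : m = m.-1.+1 by lia.
  have edown : down m i.+1 = T m *m down m.-1 i by rewrite {1}em downS -?em //; lia.
  have ecomm : down m.-1 i *m T a = T a *m down m.-1 i.
    elim: i {hi edown} => [|i IHi]; first by rewrite mul1mx mulmx1.
    rewrite /= -mulmxA Tcomm; last by lia.
    by rewrite mulmxA IHi mulmxA.
  have hwm : w *m T m = - w by apply: hwT; lia.
  (* The braid relation and w T_m = - w show that T_a does not lead out of the span of the
     translates of [phi]. *)
  have hb : w *m T a *m T m *m T a = - (w *m T a *m T m).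
    have hb : T m *m T a *m T m = T a *m T m *m T a by apply: Tbraid; lia.
    by rewrite -mulmxA -mulmxA (mulmxA (T a)) -hb 2!mulmxA hwm !mulNmx.
  have e : phi *m T m *m T a = - (phi *m T m + phi).
    by rewrite /phi !mulmxDl hb hwm mulNmx -addrA [_ + w]addrC addKr opprD.
  rewrite edown -!mulmxA ecomm !mulmxA e mulNmx mulmxDl eqmx_opp addmx_sub //.
    rewrite -mulmxA -edown -(eqmxMr _ (genmxE phi)); apply: down_sub_ext; lia.
  apply: submx_trans (sub_ext _ _); apply: (Tstable_down (k := m.-1)); last by rewrite genmxE.
  by rewrite -em.
have UX : (U <= X)%MS.
  have hphi : (<<phi>> <= X)%MS.
    by rewrite genmxE addmx_sub //; apply: (Tstable_sub hX).
  by apply: ext_sub => // s hs; apply: hX; lia.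
have U_eig : U *m JM a = j m *: U.
  suff h (Y : 'rV_d) : (Y <= U)%MS -> Y *m JM a = j m *: Y.
    apply/row_matrixP => i; rewrite row_mul h ?row_sub //.
    by apply/rowP => k; rewrite !mxE.
  suff h : (U <= kermx (JM a - (j m)%:M))%MS.
    move=> hY; have := submx_trans hY h; rewrite (sameP sub_kermxP eqP) mulmxBr.
    by rewrite mul_mx_scalar subr_eq0 => /eqP.
  apply/sumsmx_subP => -[i hi] _ /=; rewrite (eqmxMr _ (genmxE _)).
  have hcd : down m i *m JM a = JM a *m down m i by apply: JM_comm_down; lia.
  apply/sub_kermxP; rewrite mulmxBr -(mulmxA phi) hcd (mulmxA phi).
  have -> : phi *m JM a = j m *: phi.
    have hT : T a *m JM a = (q - 1) *: JM a + JM m *m T a := T_JM ha.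
    have hwm : w *m JM m = j m *: w by apply: hw; lia.
    have hwa : w *m JM a = j a *: w by apply: hw; lia.
    rewrite mulmxDl -mulmxA hT mulmxDr -scalemxAr hwa mulmxA hwm -scalemxAl.
    have -> : j m = q * j a := content_valS m.
    by rewrite addrAC scalerA -scalerDl mulrBl mul1r subrK addrC -scalerDr.
  by rewrite mul_mx_scalar -scalemxAl subrr.
have phi0 : phi = 0.
  case: (hsX.2 U U_st UX) => [U0|XU].
    by apply/eqP; rewrite -submx0 -(genmxE phi) -U0 sub_ext.
  have hwU := submx_trans hwX XU.
  have : w *m JM a = j m *: w by case/submxP: hwU => D ->; rewrite -mulmxA U_eig scalemxAr.
  rewrite (hw a (proj2 (andP ha))).
  move/eqP; rewrite -subr_eq0 -scalerBl scaler_eq0 (negbTE w0) orbF subr_eq0.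
  by rewrite eq_sym (negbTE (content_val_neq m)).
move=> s hs; have [hsa|hsa] := ltnP s a; first by apply: hwT; lia.
have -> : s = a by lia.
by apply/eqP; rewrite -addr_eq0 -/phi phi0.
Qed.

End TypeAModule.

(** * Jucys-Murphy elements and generic eigenbases *)

HB.instance Definition _ (R : pzSemiRingType) (d : nat) :=
  Monoid.isLaw.Build 'M[R]_d 1%:M (@mulmx R d d d)
    (@mulmxA R d d d d) (@mul1mx R d d) (@mulmx1 R d d).

Section JucysMurphy.
Variables (n : nat).

Definition jm_word (R : comNzRingType) d (T : 'I_n -> 'M[R]_d) (i : 'I_n) : 'M_d :=
  (\big[mulmx/1%:M]_(j <- rev (enum 'I_n) | (j <= i)%N) T j)
  *m \big[mulmx/1%:M]_(j < n | (0 < j <= i)%N) T j.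

(* q^n L_i, a polynomial in q and the T_j. *)
Definition jm (R : comNzRingType) d (q : R) (T : 'I_n -> 'M[R]_d) (i : 'I_n) : 'M_d :=
  q ^+ (n - i) *: jm_word T i.

Definition jm_value (R : comNzRingType) (q : R) (c : 'I_n -> R) (i : 'I_n) : R :=
  q ^+ (n - i) * ((\prod_(j <- rev (enum 'I_n) | (j <= i)%N) c j)
   * \prod_(j < n | (0 < j <= i)%N) c j).

Lemma halg_jm (R : comNzRingType) d q (T : 'I_n -> 'M[R]_d) c i :
  halg T c (jm q T i) (jm_value q c i).
Proof.
rewrite /jm -mul_scalar_mx; apply: halg_mul; first exact: halg_scalar.
by apply: halg_mul; apply: halg_big => j _; apply: halg_gen.
Qed.

Lemma map_jm (R R' : comNzRingType) (f : {rmorphism R -> R'}) d q (T : 'I_n -> 'M[R]_d) i :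
  map_mx f (jm q T i) = jm (f q) (fun j => map_mx f (T j)) i.
Proof.
rewrite /jm map_mxZ rmorphXn /= /jm_word map_mxM.
congr (_ *: (_ *m _)); apply: (big_morph (map_mx f)) => //;
  by [exact: map_mxM | exact: map_mx1].
Qed.

Section Words.
Variables (R : comNzRingType) (d : nat) (T : 'I_n -> 'M[R]_d).

(** Indexed by nat, with default 0 from n on, so that recursions on the index can be written. *)
Definition genT (k : nat) : 'M[R]_d := oapp T 0 (insub k).

Lemma genTE (i : 'I_n) : genT i = T i.
Proof. by rewrite /genT valK. Qed.

Lemma filter_iota_le k : (k < n)%N -> [seq j <- iota 0 n | (j <= k)%N] = iota 0 k.+1.
Proof.
move=> hk; rewrite -{1}(subnKC hk) iotaD filter_cat -[RHS]cats0; congr (_ ++ _).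
  by apply/all_filterP/allP => j; rewrite mem_iota => /andP[_]; rewrite add0n ltnS.
apply/eqP; rewrite -(negbK (_ == _)) -has_filter; apply/hasPn => j.
by rewrite mem_iota add0n => /andP[h _]; rewrite -ltnNge.
Qed.

Lemma jm_word_nat (i : 'I_n) : jm_word T i =
  (\big[mulmx/1%:M]_(j <- rev (iota 0 i.+1)) genT j)
  *m \big[mulmx/1%:M]_(j <- iota 1 i) genT j.
Proof.
rewrite /jm_word; congr (_ *m _).
  rewrite -filter_iota_le ?ltn_ord // -filter_rev big_filter -val_enum_ord -map_rev big_map.
  by apply: eq_bigr => j _; rewrite genTE.
rewrite (eq_bigr (fun j : 'I_n => genT j)) => [|j _]; last by rewrite genTE.
rewrite -(big_mkord (fun j => 0 < j <= i)%N) /index_iota subn0 -big_filter.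
congr (bigop _ _ _); have := filter_iota_le (ltn_ord i).
move/(congr1 (filter (fun j => 0 < j)%N)); rewrite -filter_predI.
rewrite (eq_filter (a2 := fun j => 0 < j <= i)%N) // => -> /=.
by apply/all_filterP/allP => j; rewrite mem_iota => /andP[].
Qed.

End Words.

Lemma jm_JM (F : fieldType) d q (T : 'I_n -> 'M[F]_d) (i : 'I_n) : q != 0 ->
  jm q T i = q ^+ n *: JM q (genT T) i.
Proof.
move=> q0; rewrite /jm jm_word_nat.
have -> : q ^+ n = q ^+ (n - i) * q ^+ i by rewrite -exprD subnK // ltnW.
rewrite -scalerA; congr (_ *: _).
elim: (nat_of_ord i) => [|k IH].
  by rewrite /= !big_cons !big_nil !mulmx1 expr0 scale1r.
have -> : rev (iota 0 k.+2) = k.+1 :: rev (iota 0 k.+1).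
  by rewrite -(addn1 k.+1) iotaD rev_cat.
have -> : iota 1 k.+1 = iota 1 k ++ [:: k.+1] by rewrite -{1}(addn1 k) iotaD.
rewrite big_cons big_cat /= big_cons big_nil mulmx1 mulmxA.
rewrite -(mulmxA (genT T k.+1)) IH -scalemxAr -scalemxAl.
by rewrite scalerA exprSr mulfK.
Qed.

Lemma jm_jucys_murphy (F : fieldType) (q : F) (Q : F * F) (V : heckeModule n q Q) i :
  q != 0 -> jm q V i = q ^+ n *: jucys_murphy V i.
Proof.
move=> q0; rewrite /jucys_murphy scalerA /jm; congr (_ *: _).
by rewrite expfB_cond // (negbTE q0) add0n ltnW.
Qed.

End JucysMurphy.

(** * Generic annihilating products and projectors *)

Section Generic.
Variables (A : comNzRingType) (K : fieldType) (vl : {rmorphism A -> K}).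
Variables (n : nat) (q : A) (Q : A * A).
Hypotheses (vl_inj : injective vl) (q_neq0 : vl q != 0).
Implicit Types (lam : bipart) (V : heckeModule n q Q) (t : tableau n).

(* q^n Q_c q^(b - a) *)
Definition scaled_residue t (i : 'I_n) : A :=
  comp Q (tcomp t i) * q ^+ (n + tcol t i - trow t i).

Lemma form_eigenbasis lam V : is_simple_at lam (base_change vl V) ->
  exists B : 'M[K]_(#|std_tableaux n lam|, hrank V),
    [/\ row_free B, row_full B & forall k i,
      row k B *m map_mx vl (jm q V i) = vl (scaled_residue (enum_val k) i) *: row k B].
Proof.
case=> _ [B [h1 h2 h3]]; exists B; split=> // k i.
rewrite map_jm; have -> := @jm_jucys_murphy n K _ _ (base_change vl V) i q_neq0.
rewrite -scalemxAr h3 scalerA; congr (_ *: _).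
rewrite /residue /scaled_residue mulrCA rmorphM rmorphXn.
have -> : comp (vl Q.1, vl Q.2) (tcomp (enum_val k) i) =
  vl (comp Q (tcomp (enum_val k) i)) by case: (tcomp _ _).
congr (_ * _); rewrite !exprnP -expfzDr //; congr (_ ^ _).
have := ltn_ord (trow (enum_val k) i); lia.
Qed.

Lemma row_prod_eigen (R : comNzRingType) d (r : 'rV[R]_d) (I : Type) (s : seq I)
    (P : pred I) (M : I -> 'M[R]_d) (a b : I -> R) :
  (forall i, r *m M i = a i *: r) ->
  r *m \big[mulmx/1%:M]_(i <- s | P i) (M i - (b i)%:M) =
  (\prod_(i <- s | P i) (a i - b i)) *: r.
Proof.
move=> h; elim: s => [|i s IH]; first by rewrite !big_nil mulmx1 scale1r.
rewrite !big_cons; case: ifP => // _.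
by rewrite mulmxA mulmxBr h mul_mx_scalar -scalerBl -scalemxAl IH scalerA mulrC.
Qed.

Lemma map_prod_sub (R R' : comNzRingType) (f : {rmorphism R -> R'}) d (I : Type)
    (s : seq I) (P : pred I) (M : I -> 'M[R]_d) (b : I -> R) :
  map_mx f (\big[mulmx/1%:M]_(i <- s | P i) (M i - (b i)%:M)) =
  \big[mulmx/1%:M]_(i <- s | P i) (map_mx f (M i) - (f (b i))%:M).
Proof.
rewrite (big_morph (map_mx f) (id1 := 1%:M) (op1 := mulmx)).
- by apply: eq_bigr => i _; rewrite map_mxB map_scalar_mx.
- exact: map_mxM.
- exact: map_mx1.
Qed.

Lemma val_mx_inj m1 m2 : injective (map_mx vl : 'M_(m1, m2) -> 'M_(m1, m2)).
Proof.
move=> X Y /matrixP h; apply/matrixP => i j; apply: vl_inj.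
by have := h i j; rewrite !mxE.
Qed.

(** The factor of [t] kills the basis vector of [t]. The index [f t] at which it is taken is free;
    the applications choose it where the residue of [t] differs from a prescribed one. *)
Lemma form_vanish lam V (f : tableau n -> 'I_n) : is_simple_at lam (base_change vl V) ->
  \big[mulmx/1%:M]_(t in std_tableaux n lam)
    (jm q V (f t) - (scaled_residue t (f t))%:M) = 0.
Proof.
move=> /form_eigenbasis[B [_ /row_fullP[B' hB'] hB]]; apply: val_mx_inj.
rewrite map_prod_sub map_mx0 -[LHS]mul1mx -{1}hB' -mulmxA.
set X := (X in B *m X); suff -> : B *m X = 0 by rewrite mulmx0.
apply/row_matrixP => k; rewrite row_mul row0 {}/X.
apply: etrans (@row_prod_eigen K _ (row k B) _ _ _ (fun t => map_mx vl (jm q V (f t)))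
  (fun t => vl (scaled_residue (enum_val k) (f t))) (fun t => vl (scaled_residue t (f t)))
  _) _ => //.
rewrite (bigD1 (enum_val k)) /= ?subrr ?mul0r ?scale0r //; exact: enum_valP.
Qed.

(* Spectral projector, up to the scalar z, onto the line of the tableau t0: a matrix over
   the Laurent ring that becomes of rank one over the field of fractions. *)
Lemma form_projector lam V t0 (f : tableau n -> 'I_n) : is_simple_at lam (base_change vl V) ->
  t0 \in std_tableaux n lam ->
  let Z := \big[mulmx/1%:M]_(t in std_tableaux n lam | t != t0)
    (jm q V (f t) - (scaled_residue t (f t))%:M) in
  [/\ forall i j k l, Z i j * Z k l = Z i l * Z k j,
      \tr Z = \prod_(t in std_tableaux n lam | t != t0)
        (scaled_residue t0 (f t) - scaled_residue t (f t)) &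
      forall i, Z *m jm q V i = scaled_residue t0 i *: Z].
Proof.
move=> /form_eigenbasis[B [/row_freeP[B2 hB2] /row_fullP[B1 hB1] hB]] ht0 Z.
set z := (\prod_(t in _ | _) _).
have eB : B1 = B2 by rewrite -[B1]mulmx1 -hB2 mulmxA hB1 mul1mx.
pose k0 := enum_rank_in ht0 t0.
have ek0 : enum_val k0 = t0 by rewrite /k0 enum_rankK_in.
have BZ : B *m map_mx vl Z = vl z *: (delta_mx k0 k0 *m B).
  apply/row_matrixP => k; rewrite row_mul map_prod_sub.
  apply: etrans (@row_prod_eigen K _ (row k B) _ _ _ (fun t => map_mx vl (jm q V (f t)))
  (fun t => vl (scaled_residue (enum_val k) (f t))) (fun t => vl (scaled_residue t (f t)))
  _) _ => //.
  have -> : row k (vl z *: (delta_mx k0 k0 *m B)) = vl z *: (row k (delta_mx k0 k0) *m B).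
    by rewrite -row_mul; apply/rowP => l; rewrite !mxE.
  rewrite [row k (delta_mx _ _)]rowE mul_delta_mx_cond.
  have [->|hk] := eqVneq k k0.
    rewrite mulr1n -rowE ek0 /z rmorph_prod; congr (_ *: _).
    by apply: eq_bigr => t _; rewrite rmorphB.
  rewrite mulr0n mul0mx scaler0 (bigD1 (enum_val k)) /=.
    by rewrite subrr mul0r scale0r.
  by rewrite enum_valP -ek0 (inj_eq enum_val_inj) hk.
(* Over K the matrix is z times column [k0] of [B1] times row [k0] of [B]; the minors and the trace
   are read off from this. *)
have eZ i j : vl (Z i j) = vl z * (B1 i k0 * B k0 j).
  have -> : vl (Z i j) = (map_mx vl Z) i j by rewrite mxE.
  rewrite -[map_mx vl Z]mul1mx -hB1 -mulmxA BZ -scalemxAr mxE; congr (_ * _).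
  rewrite mulmxA mxE (bigD1 k0) //= big1 ?addr0 => [|k hk]; last first.
    rewrite mxE big1 ?mul0r // => l _.
    by rewrite mxE (negbTE hk) andbF mulr0.
  rewrite mxE (bigD1 k0) //= big1 ?addr0 => [|k hk]; last first.
    by rewrite mxE (negbTE hk) mulr0.
  by rewrite mxE !eqxx mulr1.
split.
- by move=> i j k l; apply: vl_inj; rewrite !rmorphM /= !eZ; ring.
- apply: vl_inj; rewrite /mxtrace rmorph_sum /=.
  under eq_bigr do rewrite eZ.
  rewrite -mulr_sumr -[RHS]mulr1; congr (_ * _).
  have /matrixP/(_ k0 k0) := hB2; rewrite mxE mxE eqxx => h.
  by apply: etrans h; apply: eq_bigr => i _; rewrite eB mulrC.
- move=> i; apply: val_mx_inj; rewrite map_mxM map_mxZ.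
  set J := map_mx vl (jm q V i).
  have hd : delta_mx k0 k0 *m B *m J = vl (scaled_residue t0 i) *: (delta_mx k0 k0 *m B).
    apply/row_matrixP => k; rewrite [RHS]linearZ /= !row_mul.
    rewrite [row k (delta_mx _ _)]rowE mul_delta_mx_cond.
    have [_|hk] := eqVneq k k0; last by rewrite mulr0n !mul0mx scaler0.
    by rewrite mulr1n -rowE hB ek0.
  rewrite -[map_mx vl Z]mul1mx -hB1 -(mulmxA B1) BZ -scalemxAr -scalemxAl -mulmxA hd.
  by rewrite -scalemxAr !scalerA mulrC.
Qed.

End Generic.

(** Minors and trace pass through ring morphisms, so both hypotheses can be checked before
    specializing. A row through a nonzero diagonal entry spans the row space. *)
Lemma rank_one_matrix (F : fieldType) d (E : 'M[F]_d) :
  (forall i j k l, E i j * E k l = E i l * E k j) -> \tr E != 0 ->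
  exists w : 'rV_d, [/\ w != 0, (E <= w)%MS & (w <= E)%MS].
Proof.
move=> hE htr; have [k hk] : exists k, E k k != 0.
  apply/existsP; apply: contra_neqT htr; rewrite negb_exists => /forallP h.
  by apply: big1 => k _; apply/eqP; have := h k; rewrite negbK.
exists (row k E); split; last exact: row_sub.
  by apply: contraNneq hk => /rowP/(_ k); rewrite !mxE => ->.
apply/submxP; exists (\col_i (E i k / E k k)); apply/matrixP => i j.
rewrite mxE big_ord1 !mxE; apply: (mulfI hk).
by rewrite mulrA mulrCA mulfV // mulr1 mulrC hE.
Qed.

(** * Specialization *)

Lemma halg_sub (R : comNzRingType) n d (T : 'I_n -> 'M[R]_d) c A a b :
  halg T c A a -> halg T c (A - b%:M) (a - b).
Proof.
move=> h; apply: halg_add => //; rewrite -raddfN; exact: halg_scalar.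
Qed.

Lemma halg_scale (R : comNzRingType) n d (T : 'I_n -> 'M[R]_d) c A a b :
  halg T c A a -> halg T c (b *: A) (b * a).
Proof. by move=> h; rewrite -mul_scalar_mx; apply: halg_mul => //; apply: halg_scalar. Qed.

Lemma halg_scalar_gens (R : comNzRingType) n d (T : 'I_n -> 'M[R]_d) c A a :
  (forall i, T i = (c i)%:M) -> halg T c A a -> A = a%:M.
Proof.
move=> hT; elim=> [i|b|B C b b' _ -> _ ->|B C b b' _ -> _ ->] //.
- by rewrite raddfD.
- by rewrite scalar_mxM.
Qed.

Section Specialization.
Variables (A : comNzRingType) (K F : fieldType) (vl : {rmorphism A -> K}).
Variables (th : {rmorphism A -> F}) (n : nat) (q : A) (Q : A * A).
Hypotheses (vl_inj : injective vl) (q_neq0 : vl q != 0) (n_gt0 : (0 < n)%N).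
Implicit Types (lam : bipart) (V : heckeModule n q Q) (t : tableau n).
Implicit Type M : heckeModule n (th q) (th Q.1, th Q.2).

Local Notation res t i := (th (scaled_residue q Q t i)).

Lemma specialized_vanish lam V (f : tableau n -> 'I_n) :
  is_simple_at lam (base_change vl V) ->
  \big[mulmx/1%:M]_(t in std_tableaux n lam)
    (jm (th q) (base_change th V) (f t) - (res t (f t))%:M) = 0.
Proof.
move=> hV; have := congr1 (map_mx th) (form_vanish vl_inj q_neq0 f hV).
rewrite map_prod_sub map_mx0 => h; apply: etrans h; apply: eq_bigr => t _.
by rewrite map_jm.
Qed.

Lemma comp_mult_tableau lam V M c : is_simple_at lam (base_change vl V) ->
  is_character M c -> comp_mult (base_change th V) M <> 0%N ->
  exists2 t, t \in std_tableaux n lam & forall i, res t i = jm_value (th q) c i.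
Proof.
move=> hV hM /comp_mult_neq0[U [W [[_ hW _ _] hiso]]].
apply: contrapT => hno.
(* An index where the residues of [t] differ from the values of [M]; for standard [t] the default is
   never reached. *)
pose f t := odflt (Ordinal n_gt0) [pick i | res t i != jm_value (th q) c i].
have hf t : t \in std_tableaux n lam -> res t (f t) != jm_value (th q) c (f t).
  move=> ht; rewrite /f; case: pickP => //= h; case: hno; exists t => // i.
  by have := h i => /negbFE/eqP.
have hZ := specialized_vanish f hV.
have hh : halg (base_change th V) c
    (\big[mulmx/1%:M]_(t in std_tableaux n lam)
      (jm (th q) (base_change th V) (f t) - (res t (f t))%:M))
    (\prod_(t in std_tableaux n lam) (jm_value (th q) c (f t) - res t (f t))).
  by apply: halg_big => t _; apply: halg_sub; apply: halg_jm.
have := factor_iso_eigenvalue hM hW hiso hh hZ.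
move/eqP; rewrite prodf_seq_eq0 => /hasP[t _ /andP[ht]].
by rewrite subr_eq0 eq_sym (negbTE (hf t ht)).
Qed.

(** By uniqueness of [t0] the trace of the generic projector specializes to a nonzero scalar, so the
    image is a line, that of [w]. A factor isomorphic to [M] sees [w] because the normalized
    projector is 1 on [M]. The last hypothesis supplies the converse, which residues alone do not
    give. *)
Lemma comp_mult_character lam V M c t0 : is_simple_at lam (base_change vl V) ->
  is_character M c -> t0 \in std_tableaux n lam ->
  (forall i, res t0 i = jm_value (th q) c i) ->
  (forall t, t \in std_tableaux n lam -> (forall i, res t i = res t0 i) -> t = t0) ->
  (forall (w : 'rV_(hrank V)) (U W : 'M_(hrank V)),
     (forall i, w *m jm (th q) (base_change th V) i = res t0 i *: w) ->
     @hcover _ _ _ _ (base_change th V) U W -> (w <= W)%MS -> ~~ (w <= U)%MS ->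
     forall i, (w *m base_change th V i - c i *: w <= U)%MS) ->
  comp_mult (base_change th V) M = 1%N.
Proof.
move=> hV hM ht0 hc huniq hw.
pose f t := odflt (Ordinal n_gt0) [pick i | res t i != res t0 i].
have hf t : (t \in std_tableaux n lam) && (t != t0) -> res t (f t) != res t0 (f t).
  case/andP=> ht /eqP hne; rewrite /f; case: pickP => //= h; case: hne.
  by apply: huniq => // i; have := h i => /negbFE/eqP.
pose Z := \big[mulmx/1%:M]_(t in std_tableaux n lam | t != t0)
  (jm q V (f t) - (scaled_residue q Q t (f t))%:M).
pose z := \prod_(t in std_tableaux n lam | t != t0)
  (scaled_residue q Q t0 (f t) - scaled_residue q Q t (f t)).
have [hmin htr heig] := form_projector vl_inj q_neq0 f hV ht0.
rewrite -/Z -/z in hmin htr heig.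
pose E := map_mx th Z.
have hz : th z = \prod_(t in std_tableaux n lam | t != t0) (res t0 (f t) - res t (f t)).
  by rewrite rmorph_prod; apply: eq_bigr => t _; rewrite rmorphB.
have z0 : th z != 0.
  rewrite hz prodf_seq_neq0; apply/allP => t _; apply/implyP => /hf.
  by rewrite subr_eq0 eq_sym.
have trE : \tr E = th z by rewrite -htr /E rmorph_sum; apply: eq_bigr => i _; rewrite mxE.
have [||w [w0 Ew wE]] := @rank_one_matrix F _ E.
- by move=> i j k l; rewrite !mxE -!rmorphM hmin.
- by rewrite trE.
have hE : halg (base_change th V) c ((th z)^-1 *: E) 1.
  rewrite -(mulVf z0) hz; apply: halg_scale; rewrite /E /Z map_prod_sub.
  rewrite [X in halg _ _ _ X](eq_bigr (fun t => jm_value (th q) c (f t) - res t (f t))).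
    by apply: halg_big => t _; apply: halg_sub; rewrite map_jm; apply: halg_jm.
  by move=> t _; rewrite hc.
have hEw : ((th z)^-1 *: E <= w)%MS by apply: scalemx_sub.
have hwe i : w *m jm (th q) (base_change th V) i = res t0 i *: w.
  case/submxP: wE => D ->; rewrite -mulmxA.
  by rewrite -[jm _ _ i](map_jm th) -map_mxM heig map_mxZ -scalemxAr.
apply: (@comp_mult_eq1 _ _ _ _ (base_change th V) M w w0) => U W hUW; split.
  by move=> hiso; apply: factor_iso_vector hM hUW hiso hE hEw.
by case=> h1 h2; apply: (vector_factor_iso hM hUW h1 h2); apply: hw hUW h1 h2.
Qed.

End Specialization.

(** * Quotient modules in coordinates *)

Section Quotient.
Variables (F : fieldType) (n : nat) (q : F) (Q : F * F) (V : heckeModule n q Q).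

(** [P] is the projection onto V / U and [P'] a linear section of it. A factor W / U thus becomes a
    submodule of a module given by matrices. *)
Lemma quotient_exists (U : 'M_(hrank V)) : hstable U ->
  exists (d : nat) (P : 'M_(hrank V, d)) (P' : 'M_(d, hrank V)) (T : 'I_n -> 'M_d),
  [/\ P' *m P = 1%:M, forall k (Y : 'M_(k, hrank V)), (Y <= U)%MS = (Y *m P == 0) &
      forall i, V i *m P = P *m T i].
Proof.
move=> hU; pose P := col_base (cokermx U).
have [P' hP'] := row_fullP (col_base_full (cokermx U)).
have hP k (Y : 'M_(k, hrank V)) : (Y <= U)%MS = (Y *m P == 0).
  by rewrite submxE -{1}(mulmx_base (cokermx U)) mulmxA mulmx_free_eq0 ?row_base_free.
exists (\rank (cokermx U)), P, P', (fun i => P' *m V i *m P); split=> // i.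
have h : (V i - P *m P' *m V i <= U)%MS.
  rewrite -[X in (X - _ <= _)%MS]mul1mx -mulmxBl; apply: submx_trans (hU i).
  by apply: submxMr; rewrite hP mulmxBl mul1mx -mulmxA hP' mulmx1 subrr.
by move: h; rewrite hP mulmxBl subr_eq0 => /eqP ->; rewrite !mulmxA.
Qed.

End Quotient.

Lemma genT_mul (R : comNzRingType) n d d' (P : 'M[R]_(d, d')) (T : 'I_n -> 'M[R]_d)
    (T' : 'I_n -> 'M[R]_d') k : (forall i, T i *m P = P *m T' i) ->
  genT T k *m P = P *m genT T' k.
Proof. by move=> h; rewrite /genT; case: insubP => [i _ _|_] /=; rewrite ?mul0mx ?mulmx0. Qed.

Lemma JM_mul (F : fieldType) n d d' (q : F) (P : 'M[F]_(d, d')) (T : 'I_n -> 'M[F]_d)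
    (T' : 'I_n -> 'M[F]_d') k : (forall i, T i *m P = P *m T' i) ->
  JM q (genT T) k *m P = P *m JM q (genT T') k.
Proof.
move=> h; elim: k => [|k IH] /=; first exact: genT_mul.
rewrite -scalemxAl -scalemxAr -!mulmxA (genT_mul _ h) (mulmxA _ P) IH.
by rewrite !mulmxA (genT_mul _ h).
Qed.

(** * The sign composition factor *)

Section SignFactor.
Variables (F : fieldType) (n e : nat) (q c0 : F) (Q : F * F).
Hypotheses (n_gt0 : (0 < n)%N) (e_gt1 : (1 < e)%N) (q_prim : e.-primitive_root q).
Hypothesis c0_neq0 : c0 != 0.
Variable V : heckeModule n q Q.
Hypothesis V0 : forall i : 'I_n, i = 0%N :> nat -> V i = c0%:M.
Local Notation res t i := (c0 * q ^+ (n + tcol t i - trow t i)).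
Hypothesis vanish : forall f : tableau n -> 'I_n,
  \big[mulmx/1%:M]_(t in std_tableaux n (sgn_shape n e))
    (jm q V (f t) - (res t (f t))%:M) = 0.

Let q_neq0 : q != 0 := prim_root_neq0 q_prim.

Let q_neq1 : q != 1.
Proof. by rewrite -[q]expr1 -(prim_order_dvd q_prim) dvdn1; lia. Qed.

Lemma sgn_residue_eq (t : tableau n) (i k : 'I_n) : (res t i == c0 * q ^+ (n - k)) =
  ((n + tcol t i - trow t i)%N == (n - k)%N %[mod e]).
Proof. by rewrite (inj_eq (mulfI c0_neq0)) (eq_prim_root_expr q_prim). Qed.

Section WithQuotient.
Variables (d : nat) (P : 'M[F]_(hrank V, d)) (P' : 'M[F]_(d, hrank V)).
Variable T : 'I_n -> 'M[F]_d.
Hypotheses (P'P : P' *m P = 1%:M) (hPT : forall i, V i *m P = P *m T i).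

Local Notation L := (JM q (genT T)).
Local Notation j := (content_val q c0).

Lemma cancelP (X Y : 'M[F]_d) : P *m X = P *m Y -> X = Y.
Proof. by move=> h; rewrite -[X]mul1mx -[Y]mul1mx -P'P -!mulmxA h. Qed.

Lemma word2 a b : P *m (genT T a *m genT T b) = genT V a *m genT V b *m P.
Proof.
have hP k := genT_mul k hPT.
by rewrite mulmxA -hP -(mulmxA _ P) -hP mulmxA.
Qed.

Lemma word3 a b c : P *m (genT T a *m genT T b *m genT T c) =
  genT V a *m genT V b *m genT V c *m P.
Proof. by rewrite mulmxA word2 -(mulmxA _ P) -(genT_mul c hPT) mulmxA. Qed.

Lemma genT_quad i : (0 < i < n)%N ->
  genT T i *m genT T i = (q - 1) *: genT T i + q%:M.
Proof.
case/andP=> i0 hi; apply: cancelP; rewrite word2.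
have -> : genT V i *m genT V i = (q - 1) *: genT V i + q%:M.
  rewrite (genTE V (Ordinal hi)); set X := V _.
  have := hecke_quad (hgenP V) (i := Ordinal hi) i0; rewrite -/X.
  rewrite mulmxBl !mulmxDr !mulmx1 mul_scalar_mx => /eqP; rewrite subr_eq0 => /eqP h.
  by apply: (addIr X); rewrite h scalerBl scale1r addrAC subrK.
rewrite mulmxDl -scalemxAl (genT_mul i hPT) mulmxDr -scalemxAr; congr (_ + _).
by rewrite mul_scalar_mx mul_mx_scalar.
Qed.

Lemma genT_braid i : (0 < i)%N -> (i.+1 < n)%N ->
  genT T i *m genT T i.+1 *m genT T i = genT T i.+1 *m genT T i *m genT T i.+1.
Proof.
move=> i0 hi; have hi' : (i < n)%N by lia.
apply: cancelP; rewrite !word3; congr (_ *m P).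
have h := hecke_braid (hgenP V) (i := Ordinal hi') (j := Ordinal hi) i0 erefl.
by rewrite -!(genTE V) in h.
Qed.

Lemma genT_comm i k : (i.+2 <= k < n)%N -> genT T i *m genT T k = genT T k *m genT T i.
Proof.
case/andP=> hik hk; have hi : (i < n)%N by lia.
apply: cancelP; rewrite !word2; congr (_ *m P).
have h := hecke_comm (hgenP V) (i := Ordinal hi) (j := Ordinal hk) hik.
by rewrite -!(genTE V) in h.
Qed.

Lemma genT_0 : genT T 0 = c0%:M.
Proof.
apply: cancelP; rewrite -(genT_mul 0 hPT) mul_mx_scalar.
rewrite (genTE V (Ordinal n_gt0)) V0 //.
by rewrite mul_scalar_mx.
Qed.

Lemma jm_transfer i : jm q V i *m P = P *m (q ^+ n *: L i).
Proof. by rewrite jm_JM // -scalemxAl (JM_mul _ i hPT) -scalemxAr. Qed.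

(** The product runs over an explicit list, over which the induction of [quotient_separation] is
    made. *)
Lemma vanish_transfer (f : tableau n -> 'I_n) :
  \big[mulmx/1%:M]_(t <- filter (mem (std_tableaux n (sgn_shape n e))) (index_enum _))
    (q ^+ n *: L (f t) - (res t (f t))%:M) = 0.
Proof.
apply: cancelP; rewrite mulmx0.
suff -> : forall r : seq (tableau n), P *m \big[mulmx/1%:M]_(t <- r)
    (q ^+ n *: L (f t) - (res t (f t))%:M) =
  \big[mulmx/1%:M]_(t <- r) (jm q V (f t) - (res t (f t))%:M) *m P.
  by rewrite big_filter vanish mul0mx.
elim=> [|t r IH]; first by rewrite !big_nil mulmx1 mul1mx.
rewrite !big_cons mulmxA -(mulmxA _ _ P) -IH mulmxA; congr (_ *m _).
rewrite mulmxBr mulmxBl jm_transfer; congr (_ - _).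
by rewrite mul_mx_scalar mul_scalar_mx.
Qed.

(** In the vanishing product, a tableau violating the sign residues at some index i >= m is
    evaluated at such an index, where its factor is a nonzero scalar on [X]. The others are
    evaluated at m - 1. What remains is a polynomial in L_(m-1) that kills [X], and its roots avoid
    [j m] by [sgn_residue_sep]. *)
Lemma quotient_separation m : (0 < m < n)%N -> exists2 rs : seq F,
  j m \notin rs &
  forall X : 'M_d, (forall i, (m <= i < n)%N -> X *m L i = j i *: X) ->
    (X *m L m.-1 <= X)%MS -> X *m factors (L m.-1) rs = 0.
Proof.
move=> hm; have hk : (m.-1 < n)%N by lia.
pose k := Ordinal hk.
have hm' : (m < n)%N by lia.
pose agree t := [forall i : 'I_n, (m <= i)%N ==> (res t i == c0 * q ^+ (n - i))].
pose rs r := [seq res t k / q ^+ n | t <- r & agree t].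
exists (rs (filter (mem (std_tableaux n (sgn_shape n e))) (index_enum _))).
  apply/mapP => -[t]; rewrite !mem_filter => /and3P[/forallP hag ht _] /eqP.
  rewrite eq_sym /content_val -(inj_eq (mulIf (expf_neq0 n q_neq0))) divfK ?expf_neq0 //.
  rewrite -mulrA [_^-1 * _]mulrC -expfB_cond ?(negbTE q_neq0) ?add0n ?(ltnW hm') //.
  rewrite (sgn_residue_eq t k (Ordinal hm')) => /eqP.
  apply: (sgn_residue_sep n_gt0 e_gt1) ht _ => //=; first by lia.
  move=> i hi; have := hag i; rewrite sgn_residue_eq => /implyP h.
  by apply/eqP/h; move: hi => /=; lia.
move=> X hX hXk.
pose f t := odflt k [pick i : 'I_n | (m <= i)%N && (res t i != c0 * q ^+ (n - i))].
suff H (r : seq (tableau n)) : exists2 g : F, g != 0 &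
    forall Y : 'M_d, (Y <= X)%MS -> Y *m \big[mulmx/1%:M]_(t <- r)
      (q ^+ n *: L (f t) - (res t (f t))%:M) = g *: (Y *m factors (L m.-1) (rs r)).
  have [g g0 /(_ X (submx_refl _))] := H (filter (mem (std_tableaux n (sgn_shape n e))) (index_enum _)).
  by rewrite vanish_transfer mulmx0 => /esym/eqP; rewrite scaler_eq0 (negbTE g0) => /eqP.
elim: r => [|t r [g g0 IH]].
  by exists 1; rewrite ?oner_neq0 // => Y _; rewrite big_nil /factors big_nil scale1r.
have eig (Y : 'M_d) i : (Y <= X)%MS -> (m <= i < n)%N -> Y *m L i = j i *: Y.
  by move=> /submxP[D ->] hi; rewrite -mulmxA hX // scalemxAr.
have [hag|hag] := boolP (agree t).
  have ft : f t = k.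
    rewrite /f; case: pickP => //= i /andP[hi]; have /forallP/(_ i) := hag.
    by rewrite hi implyTb => ->.
  exists (q ^+ n * g); first by rewrite mulf_neq0 ?expf_neq0.
  move=> Y hY; rewrite big_cons /rs /= hag /= -/(rs r) factors_cons ft.
  have -> : q ^+ n *: L k - (res t k)%:M = q ^+ n *: (L m.-1 - (res t k / q ^+ n)%:M).
    by rewrite scalerBr scale_scalar_mx mulrCA mulfV ?expf_neq0 // mulr1.
  rewrite mulmxA -scalemxAr -scalemxAl IH ?scalerA ?mulmxA //.
  rewrite mulmxBr addmx_sub //.
    by apply: submx_trans hXk; apply: submxMr.
  by rewrite eqmx_opp mul_mx_scalar scalemx_sub.
have [hmf hrf] : (m <= f t)%N /\ res t (f t) != c0 * q ^+ (n - f t).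
  rewrite /f; case: pickP => [i /andP[h1 h2] //|h] /=.
  case/negP: hag; apply/forallP => i; apply/implyP => hi.
  by have := h i; rewrite hi => /negbFE.
have hfn : (m <= f t < n)%N by rewrite hmf ltn_ord.
exists ((c0 * q ^+ (n - f t) - res t (f t)) * g).
  by rewrite mulf_neq0 // subr_eq0 eq_sym.
move=> Y hY; rewrite big_cons /rs /= (negbTE hag) -/(rs r).
rewrite mulmxA mulmxBr -scalemxAr eig // scalerA mul_mx_scalar -scalerBl -scalemxAl IH //.
rewrite scalerA; congr ((_ - _) * _ *: _); rewrite /content_val mulrCA; congr (_ * _).
by rewrite expfB_cond // (negbTE q_neq0) add0n ltnW.
Qed.

End WithQuotient.

(** In V / U the image of [W] is simple, so [simple_sign] applies at level n, where the range of
    eigenvalues prescribed on the whole module is empty. *)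
Lemma sign_composition_factor (w : 'rV_(hrank V)) (U W : 'M_(hrank V)) :
  (forall i : 'I_n, w *m jm q V i = (c0 * q ^+ (n - i)) *: w) ->
  hcover U W -> (w <= W)%MS -> ~~ (w <= U)%MS ->
  forall i : 'I_n, (0 < i)%N -> ((w *m V i + w)%R <= U)%MS.
Proof.
move=> hw [hU hW hUW hmax] hwW hwU i i0.
have [d [P [P' [T [hP'P hUP hPT]]]]] := quotient_exists hU.
rewrite hUP mulmxDl -mulmxA hPT mulmxA.
suff -> : w *m P *m T i = - (w *m P) by rewrite addNr.
rewrite -(genTE T).
have hX (Y : 'M_d) : (forall s, (Y *m T s <= Y)%MS) -> (Y <= W *m P)%MS ->
    Y = 0 \/ (W *m P <= Y)%MS.
  (* [Z] is the preimage of [Y] in V, a submodule between [U] and [W]. *)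
  move=> hY hYW; pose Z := (Y *m P' + U)%MS.
  have hYP : Y *m P' *m P = Y by rewrite -mulmxA hP'P mulmx1.
  have ZP : (Z *m P <= Y)%MS.
    rewrite addsmxMr hYP addsmx_sub submx_refl /=.
    by have := submx_refl U; rewrite hUP => /eqP ->; apply: sub0mx.
  have [||h|h] := hmax Z.
  - move=> s; rewrite addsmxMr addsmx_sub; apply/andP; split; last first.
      exact: submx_trans (hU s) (addsmxSr _ _).
    have /submxP[D hD] := hY s.
    have : (Y *m P' *m V s - D *m (Y *m P') <= U)%MS.
      by rewrite hUP mulmxBl -(mulmxA _ (V s)) hPT (mulmxA _ P) -(mulmxA D) hYP hD subrr.
    move=> h; rewrite -[X in (X <= _)%MS](subrK (D *m (Y *m P'))); apply: addmx_sub.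
      exact: submx_trans h (addsmxSr _ _).
    by apply: submx_trans (addsmxSl _ _); apply: submxMl.
  - rewrite addsmxSr addsmx_sub (ltmxW hUW) andbT.
    case/submxP: hYW => D hD.
    have h : (Y *m P' - D *m W <= U)%MS by rewrite hUP mulmxBl hYP -mulmxA hD subrr.
    rewrite -[X in (X <= _)%MS](subrK (D *m W)); apply: addmx_sub; last exact: submxMl.
    exact: submx_trans h (ltmxW hUW).
  - left; apply/eqP; rewrite -hYP -hUP; apply: submx_trans h; exact: addsmxSl.
  - by right; apply: submx_trans ZP; apply: submxMr.
have hgen (Y : 'M_d) s : (s < n)%N -> (forall s, (Y *m T s <= Y)%MS) ->
    (Y *m genT T s <= Y)%MS.
  by move=> hs h; rewrite (genTE T (Ordinal hs)).
have wP0 : w *m P != 0 by rewrite -hUP.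
have hwWP : (w *m P <= W *m P)%MS by apply: submxMr.
have gi : (0 < i < n)%N by rewrite i0 ltn_ord.
apply: (@simple_sign F d n q c0 (genT T) q_neq0 q_neq1 c0_neq0 (genT_0 hP'P hPT)
  (fun i => @genT_quad _ _ _ _ hP'P hPT i) (fun i => @genT_braid _ _ _ _ hP'P hPT i)
  (fun i k => @genT_comm _ _ _ _ hP'P hPT i k) (quotient_separation hP'P hPT)
  n <<W *m P>>%MS (w *m P)) => //.
- by rewrite n_gt0 leqnn.
- move=> s hs; rewrite (eqmxMr _ (genmxE _)) genmxE.
  rewrite -mulmxA -(genT_mul s hPT) mulmxA; apply: submxMr.
  by rewrite (genTE V (Ordinal hs)); apply: hW.
- split.
    by apply: contraNneq wP0 => h; rewrite -submx0 -h genmxE.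
  move=> Y hY; rewrite genmxE => hYW; case: (hX Y) => // [s|->|h].
  + by rewrite -(genTE T); apply: hY.
  + by left.
  + by right; rewrite genmxE.
- by move=> k /andP[h1 h2]; rewrite ltnNge h1 in h2.
- by rewrite genmxE.
- move=> k hk; rewrite -mulmxA -(JM_mul _ k hPT) mulmxA.
  have h := hw (Ordinal hk); rewrite jm_JM // -scalemxAr /= in h.
  rewrite -[w *m JM _ _ _](scalerK (expf_neq0 n q_neq0)) h scalerA -scalemxAl.
  congr (_ *: _).
  rewrite /content_val mulrCA; congr (_ * _).
  rewrite expfB_cond ?(negbTE q_neq0) ?add0n ?(ltnW hk) //.
  by rewrite mulKf // expf_neq0.
Qed.

End SignFactor.

(** * One dimensional modules *)

Section JmValue.
Variables (F : fieldType) (n : nat) (q : F).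
Hypothesis q_neq0 : q != 0.
Implicit Type c : 'I_n -> F.

(** A character is viewed as a module of 1 x 1 matrices, so that the recursion of [JM] computes its
    values. *)
Lemma jm_value_JM c (i : 'I_n) : (jm_value q c i)%:M =
  q ^+ n *: JM q (genT (fun i => (c i)%:M : 'M_1)) i.
Proof.
rewrite -jm_JM //; apply/esym/(halg_scalar_gens (T := fun i => (c i)%:M : 'M_1)) => //.
exact: halg_jm.
Qed.

Lemma jm_value0 c (i : 'I_n) : i = 0%N :> nat -> jm_value q c i = q ^+ n * c i.
Proof.
move=> hi; have /matrixP/(_ 0 0) := jm_value_JM c i.
by rewrite hi /= -hi genTE !mxE eqxx.
Qed.

Lemma jm_valueS c (i k : 'I_n) : k = i.+1 :> nat ->
  jm_value q c k = jm_value q c i * c k ^+ 2 / q.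
Proof.
move=> hk; have /matrixP/(_ 0 0) := jm_value_JM c k.
have /matrixP/(_ 0 0) := jm_value_JM c i.
rewrite hk /= -hk genTE mul_scalar_mx mul_mx_scalar !mxE eqxx !mulr1n => -> ->.
by ring.
Qed.

Lemma jm_value_const c (c0 x : F) (i : 'I_n) : (forall i : 'I_n, i = 0%N :> nat -> c i = c0) ->
  (forall i : 'I_n, (0 < i)%N -> c i = x) ->
  jm_value q c i = q ^+ n * c0 * (x ^+ 2 / q) ^+ i.
Proof.
move=> h0 hx; have [m] := ubnP (i : nat); elim: m i => // m IH i; rewrite ltnS => hi.
have [i0|i0] := posnP i; first by rewrite jm_value0 // h0 // i0 expr0 mulr1.
have hi' : (i.-1 < n)%N by have := ltn_ord i; lia.
have ei : i = (Ordinal hi').+1 :> nat by rewrite /= prednK.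
rewrite (jm_valueS _ ei) IH /=; last by lia.
by rewrite hx // -[in RHS](prednK i0) (exprSr (x ^+ 2 / q)) !mulrA.
Qed.

End JmValue.

Section Lines.
Variables (n : nat) (n_gt0 : (0 < n)%N).
Implicit Type t : tableau n.

Definition row_shape (c : bool) : bipart := if c then ([::], [:: n]) else ([:: n], [::]).
Definition col_shape (c : bool) : bipart :=
  if c then ([::], nseq n 1%N) else (nseq n 1%N, [::]).

Definition row_tableau (c : bool) : tableau n := [ffun i => (Ordinal n_gt0, i, c)].
Definition col_tableau (c : bool) : tableau n := [ffun i => (i, Ordinal n_gt0, c)].

Lemma row_shape_bipart c : is_bipart n (row_shape c).
Proof. by case: c; rewrite /is_bipart /is_part /= n_gt0 ?addn0 ?add0n eqxx. Qed.

Lemma col_shape_bipart c : is_bipart n (col_shape c).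
Proof.
have h : is_part (nseq n 1%N).
  apply/andP; split; last by apply/allP => x; rewrite mem_nseq => /andP[_ /eqP ->].
  by case: n => //= m; elim: m => //= m ->.
by case: c; rewrite /is_bipart /= h sumn_nseq mul1n ?addn0 ?add0n eqxx.
Qed.

Lemma row_shape_part c c' a : part (row_shape c) c' a = if (c' == c) && (a == 0%N) then n else 0%N.
Proof. by case: c; case: c' => /=; case: a => [|[|a]]; rewrite /part //= nth_nil. Qed.

Lemma col_shape_part c c' a : part (col_shape c) c' a = if (c' == c) && (a < n)%N then 1%N else 0%N.
Proof.
by case: c; case: c'; rewrite /part /= ?nth_nil ?nth_nseq //; case: ltnP.
Qed.

Lemma ord_inj_le_id (f : 'I_n -> 'I_n) : injective f -> (forall i, f i <= i)%N ->
  forall i, f i = i.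
Proof.
move=> hf hle i; have [m] := ubnP (i : nat); elim: m i => // m IH i; rewrite ltnS => hi.
apply/eqP; case: eqP => // hne.
have hlt : (f i < i)%N by rewrite ltn_neqAle hle andbT; apply/eqP => /val_inj.
by have /hf := IH (f i) (leq_trans hlt hi).
Qed.

Lemma std_row_le t lam i : is_bipart n lam -> t \in std_tableaux n lam ->
  (trow t i <= i)%N.
Proof.
move=> hlam ht; have [m] := ubnP (i : nat); elim: m i => // m IH i.
rewrite ltnS => him; case: (posnP (trow t i)) => [-> //|hpos].
have hb : ((trow t i).-1 < n)%N by have := ltn_ord (trow t i); lia.
have [k hk [_ hki]] := std_below (a := Ordinal hb) (b := tcol t i) hlam ht
  (leq_pred _) (leqnn _).
have {}hki : (k < i)%N by apply: hki => /=; lia.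
have := IH k (leq_trans hki him).
by rewrite {1}/trow hk /=; lia.
Qed.

Lemma std_row_shape c : std_tableaux n (row_shape c) = [set row_tableau c].
Proof.
apply/finset.setP => t; rewrite finset.in_set1; apply/idP/eqP => [ht|->].
  have [inj hin _ _] := stdP ht.
  have h i : [/\ tcomp t i = c & trow t i = Ordinal n_gt0].
    have := hin i; rewrite row_shape_part; case: ifP => // /andP[/eqP -> /eqP h0] _.
    by split=> //; apply: val_inj.
  have hcol : injective (tcol t).
    move=> i k hik; apply: inj; rewrite !tableau_eta hik.
    by have [-> ->] := h i; have [-> ->] := h k.
  have id := ord_inj_le_id hcol (fun i => std_col_le i (row_shape_bipart c) ht).
  by apply/ffunP => i; rewrite ffunE tableau_eta id; have [-> ->] := h i.
rewrite inE /trow /tcol /tcomp; apply/and4P; split.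
- by apply/injectiveP => i k; rewrite !ffunE => -[].
- by apply/forallP => i; rewrite !ffunE row_shape_part !eqxx /=.
- by apply/forallP => i; apply/forallP => k; rewrite !ffunE !eqxx /=; apply/implyP.
- by apply/forallP => i; apply/forallP => k; rewrite !ffunE !eqxx /= ltnn !andbF.
Qed.

Lemma std_col_shape c : std_tableaux n (col_shape c) = [set col_tableau c].
Proof.
apply/finset.setP => t; rewrite finset.in_set1; apply/idP/eqP => [ht|->].
  have [inj hin _ _] := stdP ht.
  have h i : [/\ tcomp t i = c & tcol t i = Ordinal n_gt0].
    have := hin i; rewrite col_shape_part; case: ifP => // /andP[/eqP -> _].
    by rewrite ltnS leqn0 => /eqP h0; split=> //; apply: val_inj.
  have hrow : injective (trow t).
    move=> i k hik; apply: inj; rewrite !tableau_eta hik.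
    by have [-> ->] := h i; have [-> ->] := h k.
  have id := ord_inj_le_id hrow (fun i => std_row_le i (col_shape_bipart c) ht).
  by apply/ffunP => i; rewrite ffunE tableau_eta id; have [-> ->] := h i.
rewrite inE /trow /tcol /tcomp; apply/and4P; split.
- by apply/injectiveP => i k; rewrite !ffunE => -[].
- by apply/forallP => i; rewrite !ffunE col_shape_part !eqxx /= ltn_ord.
- by apply/forallP => i; apply/forallP => k; rewrite !ffunE !eqxx /= ltnn !andbF.
- by apply/forallP => i; apply/forallP => k; rewrite !ffunE !eqxx /=; apply/implyP.
Qed.

Section Residues.
Variables (A : comNzRingType) (q : A) (Q : A * A) (c : bool).

Lemma row_residue0 (i : 'I_n) : i = 0%N :> nat ->
  scaled_residue q Q (row_tableau c) i = comp Q c * q ^+ n.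
Proof. by move=> hi; rewrite /scaled_residue /tcomp /tcol /trow ffunE /= hi addn0 subn0. Qed.

(** The recurrence of [jm_valueS] for a character with value q. [col_residueS] is its analogue for -
    1, whose square is kept there for uniformity. *)
Lemma row_residueS (i k : 'I_n) : k = i.+1 :> nat ->
  q * scaled_residue q Q (row_tableau c) k = q ^+ 2 * scaled_residue q Q (row_tableau c) i.
Proof.
move=> hk; rewrite /scaled_residue /tcomp /tcol /trow !ffunE /= hk !subn0 addnS.
by rewrite exprS; ring.
Qed.

Lemma col_residue0 (i : 'I_n) : i = 0%N :> nat ->
  scaled_residue q Q (col_tableau c) i = comp Q c * q ^+ n.
Proof. by move=> hi; rewrite /scaled_residue /tcomp /tcol /trow ffunE /= hi addn0 subn0. Qed.

Lemma col_residueS (i k : 'I_n) : k = i.+1 :> nat ->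
  q * scaled_residue q Q (col_tableau c) k = (- 1) ^+ 2 * scaled_residue q Q (col_tableau c) i.
Proof.
move=> hk; rewrite /scaled_residue /tcomp /tcol /trow !ffunE /= hk addn0.
rewrite sqrrN expr1n mul1r mulrCA -exprS; congr (_ * _ ^+ _).
by have := ltn_ord k; lia.
Qed.

End Residues.

End Lines.

Lemma scalar_of_rank1 (R : pzRingType) d (X : 'M[R]_d) : d = 1%N -> exists x, X = x%:M.
Proof. by move=> e; subst d; exists (X 0 0); apply: mx11_scalar. Qed.

Section OneDimensional.
Variables (A : comNzRingType) (K F : fieldType) (vl : {rmorphism A -> K}).
Variables (th : {rmorphism A -> F}) (n : nat) (q : A) (Q : A * A).
Hypotheses (vl_inj : injective vl) (q_neq0 : vl q != 0) (q2_neq1 : vl q ^+ 2 != 1).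
Hypotheses (n_gt0 : (0 < n)%N).
Variables (V : heckeModule n q Q) (lam : bipart) (t : tableau n) (c : bool) (u : A).
Hypotheses (Qc_neq0 : vl (comp Q c) != 0) (hu : u = q \/ u = - 1).
Hypotheses (hV : is_simple_at lam (base_change vl V)).
Hypotheses (std1 : std_tableaux n lam = [set t]).
Hypothesis res0 : forall i : 'I_n, i = 0%N :> nat ->
  scaled_residue q Q t i = comp Q c * q ^+ n.
Hypothesis resS : forall i k : 'I_n, k = i.+1 :> nat ->
  q * scaled_residue q Q t k = u ^+ 2 * scaled_residue q Q t i.

(** A single tableau forces rank 1. The first residue determines T_0, and the ratios of consecutive
    residues determine the squares of the other T_i. The quadratic relation leaves only q and - 1,
    which are told apart by their squares since q^2 is not 1. *)
Lemma one_dim_character :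
  is_character (base_change th V) (fun i => th (if i == 0%N :> nat then comp Q c else u)).
Proof.
have [B [hfree hfull heig]] := form_eigenbasis q_neq0 hV.
have ht : t \in std_tableaux n lam by rewrite std1 set11.
have hrk : hrank V = 1%N.
  move: hfree hfull; rewrite /row_free /row_full => /eqP -> /eqP <-.
  by rewrite std1 cards1.
have hX i : {x | V i = x%:M} by apply/cid; apply: scalar_of_rank1.
pose x i := projT1 (hX i); have xE i : V i = (x i)%:M by rewrite /x; case: (hX i).
have hres i : vl (scaled_residue q Q t i) = jm_value (vl q) (fun i => vl (x i)) i.
  have := heig (enum_rank_in ht t) i; rewrite enum_rankK_in // map_jm.
  have -> : jm (vl q) (fun j => map_mx vl (V j)) i =
    (jm_value (vl q) (fun i => vl (x i)) i)%:M.
    apply: (halg_scalar_gens (T := fun j => map_mx vl (V j))); last exact: halg_jm.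
    by move=> k; rewrite xE map_scalar_mx.
  rewrite mul_mx_scalar => /eqP; rewrite -subr_eq0 -scalerBl scaler_eq0 subr_eq0.
  case/orP=> [/eqP -> //|/eqP h0].
  have /row_freeP[B' hB'] := hfree.
  have := congr1 (mulmx^~ B') h0; rewrite mul0mx -row_mul hB' => /rowP.
  move=> /(_ (enum_rank_in ht t)); rewrite !mxE eqxx => /eqP.
  by rewrite oner_eq0.
have resS' (i k : 'I_n) : k = i.+1 :> nat -> vl q * vl (scaled_residue q Q t k) =
    vl u ^+ 2 * vl (scaled_residue q Q t i).
  by move=> hk; rewrite -rmorphXn -!rmorphM (resS hk).
have resN0 i : vl (scaled_residue q Q t i) != 0.
  have [m] := ubnP (i : nat); elim: m i => // m IH i; rewrite ltnS => hi.
  have [i0|i0] := posnP i.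
    by rewrite res0 // rmorphM rmorphXn mulf_neq0 // expf_neq0.
  have hi' : (i.-1 < n)%N by have := ltn_ord i; lia.
  have ei : i = (Ordinal hi').+1 :> nat by rewrite /= prednK.
  have e := resS' _ _ ei.
  have : vl q * vl (scaled_residue q Q t i) != 0.
    rewrite e mulf_neq0 ?IH //=; last by lia.
    rewrite expf_neq0 //; case: hu => -> //.
    by rewrite rmorphN rmorph1 oppr_eq0 oner_neq0.
  by rewrite mulf_eq0 negb_or => /andP[].
split=> // i /=; rewrite xE map_scalar_mx /=; congr (th _)%:M; apply: vl_inj.
have [i0|i0] := posnP i.
  have := hres i; rewrite res0 // jm_value0 // rmorphM rmorphXn mulrC.
  by move/(mulfI (expf_neq0 n q_neq0)).
have hi' : (i.-1 < n)%N by have := ltn_ord i; lia.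
have ei : i = (Ordinal hi').+1 :> nat by rewrite /= prednK.
have hsq : vl (x i) ^+ 2 = vl u ^+ 2.
  have := resS' _ _ ei; rewrite hres (jm_valueS q_neq0 _ ei).
  rewrite mulrC divfK // -hres mulrC.
  by move/(mulIf (resN0 _)).
have hq : (vl (x i) - vl q) * (vl (x i) + 1) = 0.
  have hXq := hecke_quad (hgenP V) i0.
  have := congr1 (map_mx vl) hXq.
  rewrite xE -raddfB -raddfD -scalar_mxM map_scalar_mx map_mx0 /=.
  have i1 : 'I_(hrank V) by rewrite hrk; exact: ord0.
  move=> /matrixP/(_ i1 i1); rewrite !mxE eqxx mulr1n rmorphM rmorphB rmorphD rmorph1.
  by [].
move/eqP: hq; rewrite mulf_eq0 subr_eq0 addr_eq0 => /orP[] /eqP hx.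
  case: hu hsq => -> //; rewrite hx rmorphN rmorph1 sqrrN expr1n => h.
  by move: q2_neq1; rewrite h eqxx.
case: hu hsq => -> //; rewrite hx ?rmorphN ?rmorph1 // sqrrN expr1n => h.
by move: q2_neq1; rewrite -h eqxx.
Qed.

End OneDimensional.

(** * The labels *)

From mathcomp Require Import mpoly.

(** L_1 = T_0, and the smallest entry always occupies the corner of its component, here the first
    one; so T_0 is Q_1 on the whole eigenbasis. *)
Lemma form_gen0 (A : comNzRingType) (K : fieldType) (vl : {rmorphism A -> K}) n (q : A)
    (Q : A * A) (V : heckeModule n q Q) lam (i : 'I_n) : injective vl -> vl q != 0 ->
  is_bipart n lam -> is_simple_at lam (base_change vl V) ->
  (forall t, t \in std_tableaux n lam -> tcomp t i = false) ->
  i = 0%N :> nat -> V i = Q.1%:M.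
Proof.
move=> vl_inj q0 hlam /(form_eigenbasis q0)[B [_ /row_fullP[B' hB'] hB]] hc hi.
apply: (val_mx_inj vl_inj); rewrite map_scalar_mx -[LHS]mul1mx -hB' -mulmxA.
suff -> : B *m map_mx vl (V i) = vl Q.1 *: B by rewrite -scalemxAr hB' scalemx1.
apply/row_matrixP => k; rewrite row_mul [RHS]linearZ /=.
have hk := enum_valP k; have := hB k i.
have e : jm (vl q) (fun j => map_mx vl (V j)) i = vl q ^+ n *: map_mx vl (V i).
  by rewrite jm_JM // -(genTE (fun j => map_mx vl (V j))) hi.
rewrite map_jm e -scalemxAr /scaled_residue hc //.
have [-> ->] := std_entry0 hlam hk hi.
rewrite addn0 subn0 rmorphM rmorphXn mulrC -scalerA.
by move/(can_inj (scalerK (expf_neq0 n q0))).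
Qed.

Section Final.
Variables (F : fieldType) (n e : nat) (eta : F) (heta : e.-primitive_root eta).
Variables (s : int * int) (v : rat * rat).
Variable V : bipart -> heckeModule n (lq F) (lQ F).
Hypotheses (n_gt0 : (0 < n)%N) (e_gt1 : (1 < e)%N) (hs : s.1 = s.2) (hv : v.1 < v.2).
Hypothesis hV : forall lam, is_bipart n lam -> is_form lam (V lam).

Local Notation th := (theta heta s : {rmorphism laurent F -> F}).
Local Notation vl := (val : {rmorphism laurent F -> ratfun F}).
Local Notation c0 := (eta ^ s.1).

Let vl_inj : injective vl. Proof. exact: val_inj. Qed.

Let q_neq0 : vl (lq F) != 0. Proof. exact: laurent_q_neq0. Qed.

Let q2_neq1 : vl (lq F) ^+ 2 != 1.
Proof.
rewrite -tofracXn -tofrac1 tofrac_eq; apply/eqP => /(congr1 (meval (fun=> 0))).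
rewrite rmorphXn /= mevalXU meval1 expr0n /= => /esym/eqP.
by rewrite oner_eq0.
Qed.

Let Q_neq0 c : vl (comp (lQ F) c) != 0.
Proof.
by case: c; rewrite tofrac_eq0; apply/eqP => /(congr1 (meval (fun=> 1)));
  rewrite mevalXU meval0 => /eqP; rewrite oner_eq0.
Qed.

Let th_q : th (lq F) = eta. Proof. exact: laurent_eval_q. Qed.

Let th_Q c : th (comp (lQ F) c) = c0.
Proof.
case: c; last exact: laurent_eval_Q1.
by rewrite hs; apply: laurent_eval_Q2.
Qed.

Let th_res t (i : 'I_n) : th (scaled_residue (lq F) (lQ F) t i) =
  c0 * eta ^+ (n + tcol t i - trow t i).
Proof. by rewrite rmorphM rmorphXn th_Q th_q. Qed.

Let eta_neq0 : eta != 0 := prim_root_neq0 heta.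

Let c0_neq0 : c0 != 0. Proof. exact: expfz_neq0. Qed.

(** The content bound makes [lam0] dominate every bipartition in which [M] occurs. A second label
    would dominate [lam0] and be dominated by it, which antisymmetry excludes. *)
Lemma label_unique lam0 t0 M c : is_bipart n lam0 -> t0 \in std_tableaux n lam0 ->
  (forall i, tcomp t0 i = false) -> is_character M c ->
  comp_mult (specialize heta s (V lam0)) M = 1%N ->
  (forall mu t, is_bipart n mu -> t \in std_tableaux n mu ->
    (forall i, c0 * eta ^+ (n + tcol t i - trow t i) = jm_value eta c i) ->
    forall i, (tcol t i + trow t0 i <= tcol t0 i + trow t i)%N) ->
  unique (@is_label F n e eta heta s v V M) lam0.
Proof.
move=> hlam ht hc hM h1 hcont.
have hll mu : is_bipart n mu -> @decomp F n e eta heta s V mu M <> 0%N -> ll s v mu lam0.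
  move=> hmu hd.
  have [t ht' hres] := comp_mult_tableau vl_inj q_neq0 n_gt0 (hV hmu) hM hd.
  apply: (ll_of_content hs hv hlam hmu ht ht' hc).
  by apply: (hcont mu) => // i; rewrite -th_res hres th_q.
split; first by split.
move=> mu [hmu hmu1 hmull]; apply: (ll_antisym (s := s) (v := v)).
  by apply: hmull => //; rewrite /decomp h1.
by apply: hll => //; rewrite hmu1.
Qed.

Lemma row_character c : is_character (specialize heta s (V (row_shape n c)))
  (fun i : 'I_n => if i == 0%N :> nat then c0 else eta).
Proof.
have hr := row_shape_bipart n_gt0 c.
have [h1 h2] := @one_dim_character _ _ _ vl th n (lq F) (lQ F) vl_inj q_neq0 q2_neq1 n_gt0
  (V (row_shape n c)) _ (row_tableau n_gt0 c) c (lq F) (Q_neq0 c) (or_introl erefl)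
  (hV hr) (std_row_shape n_gt0 c) (row_residue0 n_gt0 _ _ c) (row_residueS n_gt0 _ _ c).
by split=> // i; rewrite h2; case: ifP => _; congr (_%:M); [exact: th_Q | exact: th_q].
Qed.

Lemma col_character c : is_character (specialize heta s (V (col_shape n c)))
  (fun i : 'I_n => if i == 0%N :> nat then c0 else - 1).
Proof.
have hr := col_shape_bipart n c.
have [h1 h2] := @one_dim_character _ _ _ vl th n (lq F) (lQ F) vl_inj q_neq0 q2_neq1 n_gt0
  (V (col_shape n c)) _ (col_tableau n_gt0 c) c (- 1) (Q_neq0 c) (or_intror erefl)
  (hV hr) (std_col_shape n_gt0 c) (col_residue0 n_gt0 _ _ c) (col_residueS n_gt0 _ _ c).
by split=> // i; rewrite h2; case: ifP => _; congr (_%:M); [exact: th_Q | rewrite rmorphN rmorph1].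
Qed.

(** The character does not depend on [c] after specialization, so it occurs in the module of
    [row_shape n false]. In the row tableau the entry [i] has content i, the largest possible since
    its column never exceeds [i]. *)
Lemma row_label c : theta_label heta s v V (row_shape n c) (row_shape n false).
Proof.
have hM := row_character c; have hM0 := row_character false.
have hr := row_shape_bipart n_gt0 false.
have ht0 : row_tableau n_gt0 false \in std_tableaux n (row_shape n false).
  by rewrite std_row_shape finset.set11.
have hres i : th (scaled_residue (lq F) (lQ F) (row_tableau n_gt0 false) i) =
    jm_value (th (lq F)) (fun i : 'I_n => if i == 0%N :> nat then c0 else eta) i.
  rewrite th_res th_q (jm_value_const (c0 := c0) (x := eta) eta_neq0); first last.
  - by move=> k; case: (nat_of_ord k).
  - by move=> k ->.
  rewrite /tcol /trow ffunE /= subn0 expr2 mulfK // exprD; ring.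
apply: (label_unique hr ht0 _ hM) => [i||mu t hmu ht _ i].
- by rewrite /tcomp ffunE.
- apply: (comp_mult_character vl_inj q_neq0 n_gt0 (hV hr) hM ht0 hres) => [t|w U W _ _ _ _ i].
    by rewrite std_row_shape finset.in_set1 => /eqP.
  by rewrite (hM0.2 i) mul_mx_scalar subrr sub0mx.
- rewrite {1}/trow {2}/tcol ffunE /= addn0.
  by apply: leq_trans (std_col_le i hmu ht) (leq_addr _ _).
Qed.

Lemma col_label c : theta_label heta s v V (col_shape n c) (sgn_shape n e).
Proof.
have hM := col_character c; have hr := sgn_shape_bipart n_gt0 e_gt1.
have ht0 := sgn_tableau_std n_gt0 e_gt1.
have hjm i : jm_value eta (fun i : 'I_n => if i == 0%N :> nat then c0 else - 1) i =
    c0 * eta ^+ (n - i).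
  rewrite (jm_value_const (c0 := c0) (x := - 1) eta_neq0); first last.
  - by move=> k; case: (nat_of_ord k).
  - by move=> k ->.
  rewrite expfB_cond ?(negbTE eta_neq0) ?add0n ?(ltnW (ltn_ord i)) //.
  by rewrite sqrrN expr1n mul1r exprVn; ring.
have hsgn t (i : 'I_n) : (c0 * eta ^+ (n + tcol t i - trow t i) = c0 * eta ^+ (n - i)) <->
    sgn_residue e t i.
  by split=> [/eqP|/eqP] h; apply/eqP; move: h; rewrite (sgn_residue_eq heta c0_neq0).
have hres0 (i : 'I_n) : sgn_residue e (sgn_tableau n e) i.
  rewrite /sgn_residue; have [-> -> _] := sgn_tableauE e i.
  have := divn_eq i e.-1; have := ltn_ord i; move: (i %/ _)%N (i %% _)%N => k r hi hd.
  (* As i = k (e - 1) + r, the content k - r is k e - i. *)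
  have -> : (n + k - r = k * e + (n - i))%N by nia.
  by rewrite modnMDl.
have hres i : th (scaled_residue (lq F) (lQ F) (sgn_tableau n e) i) =
    jm_value (th (lq F)) (fun i : 'I_n => if i == 0%N :> nat then c0 else - 1) i.
  by rewrite th_res th_q hjm; apply/hsgn.
apply: (label_unique hr ht0 _ hM) => [i||mu t hmu ht hrt i].
- by have [_ _ ->] := sgn_tableauE e i.
- apply: (comp_mult_character vl_inj q_neq0 n_gt0 (hV hr) hM ht0 hres).
    move=> t ht hrt; apply: (sgn_tableau_uniq n_gt0 e_gt1) => // i.
    by apply/hsgn; rewrite -th_res hrt th_res; apply/hsgn.
  move=> w U W hw hUW h1 h2 i.
  (* This shape lives in the first component, so T_0 is scalar already on the form and the type A
     argument applies. *)
  have V0 (k : 'I_n) : k = 0%N :> nat -> specialize heta s (V (sgn_shape n e)) k = c0%:M.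
    move=> hk; rewrite /= (form_gen0 vl_inj q_neq0 hr (hV hr) _ hk).
      by rewrite map_scalar_mx; congr (_%:M); exact: (th_Q false).
    by move=> t ht; apply: sgn_comp ht.
  cbv beta; have [i0|i0] := posnP i.
    by rewrite V0 // mul_mx_scalar subrr sub0mx.
  rewrite scaleN1r opprK.
  apply: (@sign_composition_factor F n e (th (lq F)) c0 _ n_gt0 e_gt1 _ c0_neq0
    (specialize heta s (V (sgn_shape n e))) V0 _ w U W _ hUW h1 h2 i i0).
  + by rewrite th_q.
  + move=> f; apply: etrans (specialized_vanish th vl_inj q_neq0 f (hV hr)).
    by apply: eq_bigr => t _; congr (_ - _%:M); rewrite th_res th_q.
  + by move=> k; rewrite hw hres; congr (_ *: _); rewrite !th_q hjm.
- have [-> -> _] := sgn_tableauE e i; rewrite [X in (_ <= X)%N]addnC.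
  by apply: (sgn_content_le n_gt0 e_gt1 _ hmu ht) => k; apply/hsgn; rewrite hrt hjm.
Qed.

End Final.

Theorem mainTheorem6 (R : realType) (n e : nat) (s : int * int)
    (eta : R[i]) (v : rat * rat)
    (V : bipart -> heckeModule n (lq R[i]) (lQ R[i]))
    (hn : (1 <= n)%N) (he : (2 <= e)%N) (hs : s.1 = s.2)
    (heta : e.-primitive_root eta)
    (hv : v.1 < v.2 < v.1 + e%:R)
    (hV : forall lam : bipart, is_bipart n lam -> is_form lam (V lam)) :
  [/\ theta_label heta s v V ([:: n], [::]) ([:: n], [::]),
      theta_label heta s v V ([::], [:: n]) ([:: n], [::]),
      theta_label heta s v V (nseq n 1%N, [::]) (mullineux_row e n, [::]) &
      theta_label heta s v V ([::], nseq n 1%N) (mullineux_row e n, [::])].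
Proof.
have hv' : v.1 < v.2 by case/andP: hv.
split.
- exact: (row_label heta hn hs hv' hV false).
- exact: (row_label heta hn hs hv' hV true).
- exact: (col_label heta hn he hs hv' hV false).
- exact: (col_label heta hn he hs hv' hV true).
Qed.
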